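(* Let $G$ be a connected graph such that each finite set of vertices can be disconnected from infinity by removing a bounded number of edges; that is, there exists a constant $K$ such that for every finite set $A$ of vertices of $G$ there are $K$ edges $e_1(A),\dots,e_K(A)$ of $G$ such that, after removing these edges, the connected component of every $v\in A$ is finite. Then for every $p\in[0,1]$, almost surely, $p$-percolation on $G\times\mathbb{Z}$ does not have infinitely many infinite components.
   Context: $G\times\mathbb{Z}$ is the Cartesian product graph: its vertices are pairs $(v,k)$ with $v$ a vertex of $G$ and $k\in\mathbb{Z}$, and $(v,k)$ and $(w,l)$ are adjacent iff either $v=w$ and $|k-l|=1$, or $k=l$ and $v,w$ are adjacent in $G$. In $p$-percolation (Bernoulli bond percolation) each edge is independently open with probability $p$ and closed otherwise; the components (clusters) are the connected components of the subgraph of open edges. ''$K$ edges'' is to be understood as at most $K$ edges. *)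

(* Defs.v *)
From Stdlib Require Import Relation_Operators.
From mathcomp Require Import all_boot all_order all_algebra finmap.
From mathcomp Require Import all_classical all_reals all_analysis.
Set Implicit Arguments.
Unset Strict Implicit.
Unset Printing Implicit Defensive.
Import Order.TTheory GRing.Theory Num.Theory.
Local Open Scope classical_set_scope.
Local Open Scope card_scope.
Local Open Scope ring_scope.

Record graph (V : Type) := Graph {
  adj : V -> V -> Prop;
  adj_sym : forall x y, adj x y -> adj y x;
  adj_irrefl : forall x, ~ adj x x }.

(* An undirected edge is identified with the two-element set of its ends. *)
Definition edges (V : Type) (G : graph V) : set (set V) :=
  [set e | exists x y, adj G x y /\ e = [set x; y]].

Section SpanningSubgraph.
Variables (V : Type) (G : graph V) (F : set (set V)).

Definition sub_adj (x y : V) := adj G x y /\ F [set x; y].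

Lemma sub_adj_sym x y : sub_adj x y -> sub_adj y x.
Proof. by case=> xy Fxy; split; [exact: adj_sym|rewrite setUC]. Qed.

Lemma sub_adj_irrefl x : ~ sub_adj x x.
Proof. by case=> xx _; exact: (adj_irrefl xx). Qed.

(* The subgraph with all vertices of G and those edges of G that lie in F;
   elements of F that are not edges of G play no role. *)
Definition spanning_subgraph : graph V := Graph sub_adj_sym sub_adj_irrefl.

End SpanningSubgraph.

Definition delete_edges (V : Type) (G : graph V) (F : set (set V)) : graph V :=
  spanning_subgraph G (~` F).

Definition component (V : Type) (G : graph V) (x : V) : set V :=
  [set y | clos_refl_trans V (adj G) x y].

Definition connected_graph (V : Type) (G : graph V) : Prop :=
  forall x y, component G x y.

Definition infinite_components (V : Type) (G : graph V) : set (set V) :=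
  [set C | infinite_set C /\ exists x, C = component G x].

Section CartesianProductZ.
Variables (V : Type) (G : graph V).

Definition prodZ_adj (x y : V * int) :=
  (x.1 = y.1 /\ `|x.2 - y.2| = 1) \/ (x.2 = y.2 /\ adj G x.1 y.1).

Lemma prodZ_adj_sym x y : prodZ_adj x y -> prodZ_adj y x.
Proof.
by case=> [[xy d]|[xy a]]; [left; rewrite distrC|right; split=> //; exact: adj_sym].
Qed.

Lemma prodZ_adj_irrefl x : ~ prodZ_adj x x.
Proof.
by case=> [[_]|[_ xx]]; [rewrite subrr normr0|exact: (adj_irrefl xx)].
Qed.

Definition prodZ : graph (V * int) := Graph prodZ_adj_sym prodZ_adj_irrefl.

End CartesianProductZ.

Definition independent_events (d : measure_display) (T : measurableType d)
    (R : realType) (P : probability T R) (I : choiceType) (D : set I)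
    (A : I -> set T) : Prop :=
  forall J : {fset I}, [set` J] `<=` D ->
    P (\bigcap_(i in [set` J]) A i) = (\prod_(i <- J) P (A i))%E.

(* The random set [omega w] of open edges, defined on an arbitrary probability
   space, has the law of Bernoulli(p) bond percolation on G. Only the trace of
   [omega w] on the edges of G is constrained. *)
Definition bernoulli_percolation (d : measure_display) (T : measurableType d)
    (R : realType) (P : probability T R) (V : Type) (G : graph V) (p : R)
    (omega : T -> set (set V)) : Prop :=
  let isopen (e : set V) : set T := [set w | omega w e] in
  [/\ forall e, edges G e -> measurable (isopen e),
      forall e, edges G e -> P (isopen e) = p%:E &
      independent_events P (edges G) isopen].

(* The K deleted edges may be chosen depending on A, but K may not. *)
Definition boundedly_separable (V : Type) (G : graph V) : Prop :=
  exists K : nat, forall A : set V, finite_set A ->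
    exists F : set (set V),
      [/\ F `<=` edges G, F #<= `I_K &
          forall v, A v -> finite_set (component (delete_edges G F) v)].

(* Main.v *)
(* Call two vertices separated when they lie in distinct infinite clusters.
   If some pair is separated with positive probability, then so are the ends
   of some edge, because opening edges along a path merges the finite clusters
   met on the way into one of the two.

   The main estimate: if each of m edges separates its ends with probability at
   least alpha, then these edges touch at least beta m infinite clusters on
   average, where beta > 0 depends only on alpha and p.  For an infinite
   cluster C let N_C be the number of these edges that touch it and Y_C be
   p times the number of closed ones minus (1 - p) times the number of open
   ones.  Flipping one edge shows that the sum of Y_C over C has mean at least
   p alpha m.  Exploring C reveals independent coins, so an exponential tilt
   shows that Y_C exceeds epsilon N_C + k only on a contribution of mean
   O(m/k); as the N_C add up to at most 2m, there must be of order m clusters.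

   Apply this to the vertical translates of one separating edge: a column of
   height n meets of order n infinite clusters, and all but boundedly many of
   them leave through any finite cut of G, i.e. through at most K vertical
   lines.  By pigeonhole, one of these lines often meets two infinite clusters
   within a window of bounded height, so its vertical edges separate with
   probability at least alpha', independent of the cut.  This produces
   arbitrarily many vertical lines with that bound; applied to J of them, the
   main estimate gives at least beta' J n infinite clusters within height n,
   whereas at most K n + O(1) can cross a cut that surrounds the J lines. *)
Require Import Defs.
From Stdlib Require Import Relation_Operators Operators_Properties.
From mathcomp Require Import all_boot all_order all_algebra finmap.
From mathcomp Require Import all_classical all_reals all_analysis.
From mathcomp Require Import zify ring lra.
Import Order.TTheory GRing.Theory Num.Theory.
Set Implicit Arguments.
Unset Strict Implicit.
Unset Printing Implicit Defensive.
Local Open Scope classical_set_scope.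
Local Open Scope ring_scope.

(** * Clusters *)

Section Components.
Variables (T : Type) (H : graph T).

Lemma component_refl x : component H x x.
Proof. exact: rt_refl. Qed.

Lemma component_trans x y z :
  component H x y -> component H y z -> component H x z.
Proof. exact: rt_trans. Qed.

Lemma component_sym x y : component H x y -> component H y x.
Proof.
elim=> [u v uv|u|u v w _ vu _ wv]; first exact/rt_step/adj_sym.
  exact: rt_refl.
exact: component_trans wv vu.
Qed.

Lemma component_adj x y : adj H x y -> component H x y.
Proof. exact: rt_step. Qed.

Lemma component_eq x y : component H x y -> component H x = component H y.
Proof.
move=> xy; apply/seteqP; split=> z.
  exact/component_trans/component_sym.
exact: component_trans.
Qed.

Lemma component_eqP x y : component H x = component H y <-> component H x y.
Proof. by split=> [->|/component_eq//]; exact: component_refl. Qed.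

Lemma component_sub (A : set T) x : A x ->
  (forall y z, A y -> adj H y z -> A z) -> component H x `<=` A.
Proof.
move=> Ax AH y xy; elim: (clos_rt_rtn1 _ _ _ _ xy) => // u v uv _ Au.
exact: AH uv.
Qed.

Lemma component_exit (A : set T) x y : A x -> ~ A y -> component H x y ->
  exists u v, [/\ A u, ~ A v, adj H u v, component H x u & component H x v].
Proof.
move=> Ax nAy xy; apply: contra_notP nAy => nex.
suff: (A `&` component H x) y by case.
move: y xy; apply: component_sub; first by split=> //; exact: component_refl.
move=> u v [Au xu] uv; have xv := component_trans xu (component_adj uv).
by split=> //; apply: contra_notP nex => nAv; exists u, v.
Qed.

End Components.

Section Clusters.
Variables (T : Type) (H : graph T).
Implicit Types (c : set (set T)) (x y z u : T).

Definition pcluster c x : set T := component (spanning_subgraph H c) x.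

Definition inf_cluster c x := infinite_set (pcluster c x).

Definition infsep c x y :=
  [/\ inf_cluster c x, inf_cluster c y & ~ pcluster c x y].

Lemma pcluster_refl c x : pcluster c x x.
Proof. exact: component_refl. Qed.

Lemma pcluster_sym c x y : pcluster c x y -> pcluster c y x.
Proof. exact: component_sym. Qed.

Lemma pcluster_trans c x y z :
  pcluster c x y -> pcluster c y z -> pcluster c x z.
Proof. exact: component_trans. Qed.

Lemma pcluster_eqP c x y : pcluster c x = pcluster c y <-> pcluster c x y.
Proof. exact: component_eqP. Qed.

Lemma pcluster_adj c x y : adj H x y -> c [set x; y] -> pcluster c x y.
Proof. by move=> xy cxy; apply: component_adj. Qed.

Lemma infsep_sym c x y : infsep c x y -> infsep c y x.
Proof. by case=> ix iy nxy; split=> // /pcluster_sym. Qed.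

Lemma pcluster_sub c c' x :
    (forall y z, pcluster c x y -> adj H y z -> c [set y; z] -> c' [set y; z]) ->
  pcluster c x `<=` pcluster c' x.
Proof.
move=> cc' y xy; suff: (pcluster c x `&` pcluster c' x) y by case.
move: y xy; apply: component_sub; first by split; exact: component_refl.
move=> u v [cu c'u] [uv cuv]; split.
  by apply: pcluster_trans cu _; exact: pcluster_adj.
apply: pcluster_trans c'u _; apply: pcluster_adj => //; exact: cc'.
Qed.

Lemma pcluster_mono c c' x : c `<=` c' -> pcluster c x `<=` pcluster c' x.
Proof. by move=> cc'; apply: pcluster_sub => y z _ _ /cc'. Qed.

(* Only the edges revealed by the exploration of the cluster matter. *)
Lemma pcluster_stop c c' x :
    (forall y z, pcluster c x y -> adj H y z ->
      c [set y; z] <-> c' [set y; z]) ->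
  pcluster c x = pcluster c' x.
Proof.
move=> cc'; apply/seteqP; split.
  by apply: pcluster_sub => y z xy yz /(cc' _ _ xy yz).
move=> y xy; move: xy; apply: component_sub; first exact: pcluster_refl.
move=> u v xu [uv c'uv]; apply: (pcluster_trans xu).
by apply: pcluster_adj => //; apply/(cc' _ _ xu uv).
Qed.

(** The union of the three old clusters is closed under the enlarged adjacency, because the new edge
    has both its ends in it. *)
Lemma pcluster_add c x z u : pcluster (c `|` [set [set x; z]]) u `<=`
  pcluster c u `|` pcluster c x `|` pcluster c z.
Proof.
apply: component_sub; first by left; left; exact: pcluster_refl.
move=> y v yu [yv [cyv|/= exz]].
  have yv' := pcluster_adj yv cyv.
  by case: yu => [[]|] h; [left; left|left; right|right];
    exact: pcluster_trans h yv'.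
have : [set y; v] v by right.
by rewrite exz => -[->|->]; [left; right|right]; exact: pcluster_refl.
Qed.

Lemma infsep_third c x y z :
  infsep c x y -> infsep c x z \/ infsep c z y \/ ~ inf_cluster c z.
Proof.
move=> [ix iy nxy].
have [iz|] := pselect (inf_cluster c z); last by right; right.
have [xz|nxz] := pselect (pcluster c x z); last by left.
by right; left; split=> // zy; apply: nxy; exact: pcluster_trans zy.
Qed.

(** The finite cluster of [z] is absorbed into the infinite cluster of [x]. It does not contain [y],
    whose cluster is infinite, so the merged cluster still misses [y]. *)
Lemma infsep_add c x y z : adj H x z ->
    infsep c x y -> ~ inf_cluster c z ->
  infsep (c `|` [set [set x; z]]) z y.
Proof.
move=> xz [ix iy nxy] /contrapT fz.
have subc w : pcluster c w `<=` pcluster (c `|` [set [set x; z]]) w.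
  by apply: pcluster_mono => e ?; left.
have zx : pcluster (c `|` [set [set x; z]]) z x.
  by apply/pcluster_sym/pcluster_adj => //; right.
split.
- move=> fin; apply: ix; apply: sub_finite_set fin => w /subc.
  exact: pcluster_trans.
- by move=> fin; apply: iy; apply: sub_finite_set fin.
- move=> /pcluster_add [[zy|//]|zy].
    by apply: iy; move/pcluster_eqP: zy => <-.
  by apply: iy; move/pcluster_eqP: zy => <-.
Qed.

End Clusters.

Section ClusterCount.
Variables (T : choiceType) (H : graph T).
Implicit Types (c : set (set T)) (x y z u : T) (U W : seq T).

Definition infclusters c U : seq (set T) :=
  undup [seq pcluster H c u | u <- U & `[< inf_cluster H c u >]].

Definition nclusters c U : nat := size (infclusters c U).

Lemma mem_infclusters c U C :
  reflect (exists2 u, u \in U & inf_cluster H c u /\ C = pcluster H c u)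
          (C \in infclusters c U).
Proof.
rewrite mem_undup; apply: (iffP mapP) => -[u].
  by rewrite mem_filter => /andP[/asboolP iu uU] ->; exists u.
move=> uU [iu ->]; exists u => //.
by rewrite mem_filter uU andbT; exact/asboolP.
Qed.

Definition newcluster c u U :=
  inf_cluster H c u /\ (forall v, v \in U -> ~ pcluster H c u v).

(** Unfolding the count vertex by vertex presents it as a finite sum of indicators of measurable
    events; [simple_count] rests on this. *)
Lemma nclusters_cons c u U :
  nclusters c (u :: U) = (`[< newcluster c u U >] + nclusters c U)%N.
Proof.
rewrite /nclusters /infclusters /=; case: asboolP => [iu|niu] /=; last first.
  by case: asboolP => // -[].
case: ifPn => [|/negP nu].
  rewrite -mem_undup => /mem_infclusters[v vU [iv /pcluster_eqP uv]].
  by case: asboolP => // -[_ /(_ _ vU)].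
case: asboolP => //= -[]; split=> // v vU uv; apply: nu.
rewrite -mem_undup; apply/mem_infclusters; exists v => //.
by move/pcluster_eqP : (uv) => uvE; split=> //; rewrite /inf_cluster -uvE.
Qed.

Lemma nclusters_le c U W :
    (forall u, u \in U -> inf_cluster H c u ->
      exists2 w, w \in W & pcluster H c u w) ->
  (nclusters c U <= nclusters c W)%N.
Proof.
move=> UW; apply: uniq_leq_size; first exact: undup_uniq.
move=> C /mem_infclusters[u uU [iu ->]].
have [w wW /pcluster_eqP uw] := UW _ uU iu.
by apply/mem_infclusters; exists w => //; rewrite /inf_cluster -uw.
Qed.

Lemma nclusters_size c U : (nclusters c U <= size U)%N.
Proof.
rewrite /nclusters (leq_trans (size_undup _))// size_map size_filter.
exact: count_size.
Qed.

Lemma nclusters_cat c U W :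
  (nclusters c (U ++ W) <= nclusters c U + nclusters c W)%N.
Proof.
elim: U => [|u U IH]; first by rewrite cat0s leq_addl.
rewrite cat_cons !nclusters_cons -addnA leq_add//.
case: asboolP => // -[iu nu]; case: asboolP => // -[]; split=> // v vU.
by apply: nu; rewrite mem_cat vU.
Qed.

(** Take [u] in the first listed cluster: every other listed cluster contains some [v] of [U]
    separated from [u], so the row of [u] in the double sum already suffices. *)
Lemma nclusters_infsep c U : (nclusters c U <=
  1 + \sum_(u <- U) \sum_(v <- U) `[< infsep H c u v >])%N.
Proof.
rewrite /nclusters; case E : (infclusters c U) => [//|C s] /=.
rewrite add1n ltnS.
have := undup_uniq [seq pcluster H c u | u <- U & `[< inf_cluster H c u >]].
rewrite -/(infclusters c U) E /= => /andP[Cs us].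
have : C \in infclusters c U by rewrite E mem_head.
move=> /mem_infclusters[u uU [iu Cu]].
rewrite (big_rem u)//= -[X in (X <= _)%N]addn0 leq_add//.
have : {subset s <= [seq pcluster H c v | v <- U & `[< infsep H c u v >]]}.
  move=> D Ds; have : D \in infclusters c U by rewrite E inE Ds orbT.
  move=> /mem_infclusters[v vU [iv Dv]].
  apply/mapP; exists v => //; rewrite mem_filter vU andbT.
  apply/asboolP; split=> // /pcluster_eqP uv.
  by move: Cs; rewrite Cu uv -Dv Ds.
move=> /(uniq_leq_size us)/leq_trans; apply.
by rewrite size_map size_filter -sum1_count big_mkcond.
Qed.

End ClusterCount.

(** * Independent coins *)

Section ProductWeight.
Variables (R : realFieldType) (I : finType).
Implicit Types (rho phi : bool -> R) (s t : {ffun I -> bool}) (J : {set I}).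

Definition weight rho s : R := \prod_i rho (s i).

Lemma sum_prod_bool (F : I -> bool -> R) :
  \sum_(s : {ffun I -> bool}) \prod_i F i (s i) =
  \prod_i (F i true + F i false).
Proof.
rewrite -(bigA_distr_bigA F); apply: eq_bigr => i _.
by rewrite big_bool.
Qed.

Lemma sum_weight rho : rho true + rho false = 1 -> \sum_s weight rho s = 1.
Proof. by move=> rho1; rewrite /weight (sum_prod_bool (fun _ => rho)) big1. Qed.

Lemma weight_ge0 rho s : (forall b, 0 <= rho b) -> 0 <= weight rho s.
Proof. by move=> rho0; apply: prodr_ge0. Qed.

Definition splice J s t : {ffun I -> bool} :=
  [ffun i => if i \in J then s i else t i].

(* Swapping two independent samples off the stopping set is an involution;
   it exchanges a sample that is tilted everywhere with one that is tilted
   exactly on the stopping set. *)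
Lemma sum_weight_stop (J : {ffun I -> bool} -> {set I}) rho phi :
    (forall s t, (forall i, i \in J s -> t i = s i) -> J t = J s) ->
    rho true + rho false = 1 ->
    rho true * phi true + rho false * phi false = 1 ->
  \sum_s weight rho s * \prod_(i in J s) phi (s i) = 1.
Proof.
move=> stop rho1 phi1; pose rho' b := rho b * phi b.
pose h (st : {ffun I -> bool} * {ffun I -> bool}) :=
  (splice (J st.1) st.1 st.2, splice (J st.1) st.2 st.1).
(* The spliced sample agrees with the original on the stopping set, hence has the same stopping
   set. *)
have Jh st : J (h st).1 = J st.1.
  by apply: stop => i iJ; rewrite ffunE iJ.
have hK : involutive h.
  move=> [s t]; have /= Jst := Jh (s, t); rewrite /h /= Jst.
  by congr (_, _); apply/ffunP => i; rewrite !ffunE; case: (i \in J s).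
transitivity (\sum_s \sum_t weight rho' s * weight rho t).
  rewrite pair_bigA /= (reindex_inj (inv_inj hK)) /=.
  rewrite -(pair_bigA _ (fun s t =>
    weight rho' (splice (J s) s t) * weight rho (splice (J s) t s))) /=.
  apply: eq_bigr => s _.
  transitivity (\sum_(t : {ffun I -> bool})
      weight rho s * \prod_(i in J s) phi (s i) *
      \prod_i (if i \in J s then rho (t i) else rho' (t i))).
    rewrite -mulr_sumr (sum_prod_bool
      (fun i b => if i \in J s then rho b else rho' b)).
    by rewrite [X in _ = _ * X]big1 ?mulr1// => i _; case: ifP.
  apply: eq_bigr => t _; rewrite /weight [\prod_(i in J s) _]big_mkcond.
  rewrite -!big_split /=; apply: eq_bigr => i _.
  by rewrite !ffunE /rho'; case: ifP => _; ring.
rewrite -(@sum_weight rho' phi1); apply: eq_bigr => s _.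
by rewrite -mulr_sumr sum_weight// mulr1.
Qed.

Definition setbit (i : I) b s : {ffun I -> bool} :=
  [ffun j => if j == i then b else s j].

(** Pair each sample having bit [i] true with its flip. With w the weight of the other bits, the
    difference of the two sides over a pair is w * rho true * rho false times the slack in the
    hypothesis on [c] and [D]. *)
Lemma sum_weight_flip rho (i : I) (c D : {ffun I -> bool} -> R) :
    (forall b, 0 <= rho b) -> rho true + rho false = 1 ->
    (forall s, D (setbit i true s) = 0) ->
    (forall s, c (setbit i true s) + D (setbit i false s) <=
               c (setbit i false s)) ->
  rho true * \sum_s weight rho s * D s <=
    \sum_s weight rho s * ((rho true - (s i)%:R) * c s).
Proof.
move=> rho0 rho1 D0 cD.
rewrite mulr_sumr -subr_ge0 -sumrB (bigID (fun s : {ffun I -> bool} => s i)) /=.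
pose flip (s : {ffun I -> bool}) := setbit i (~~ s i) s.
have flipK : involutive flip.
  by move=> s; apply/ffunP => j; rewrite !ffunE eqxx; case: eqP => // ->;
    rewrite negbK.
rewrite [X in _ + X](reindex_inj (inv_inj flipK)) /=.
rewrite [X in _ + X](eq_bigl (fun s : {ffun I -> bool} => s i)); last first.
  by move=> s; rewrite !ffunE eqxx negbK.
rewrite -big_split /=; apply: sumr_ge0 => s si.
have sT : setbit i true s = s.
  by apply/ffunP => j; rewrite ffunE; case: eqP => [->|].
have sF : flip s = setbit i false s by rewrite /flip si.
have := cD s; have := D0 s; rewrite sT sF => -> cs.
pose w := \prod_(j | j != i) rho (s j).
have -> : weight rho s = rho true * w by rewrite /weight (bigD1 i)//= si.
have -> : weight rho (setbit i false s) = rho false * w.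
  rewrite /weight (bigD1 i)//= ffunE eqxx; congr (_ * _).
  by apply: eq_bigr => j /negbTE ji; rewrite ffunE ji.
rewrite si ffunE eqxx /=.
have w0 : 0 <= w by apply: prodr_ge0.
have -> : rho false = 1 - rho true by lra.
have r0 := rho0 true; have := rho0 false.
have -> : rho false = 1 - rho true by lra.
move: (rho true) (c s) (c (setbit i false s)) (D (setbit i false s)) r0 cs w0.
move=> r a b d r0 abd w0 r1.
have -> : r * w * ((r - 1) * a) - r * (r * w * 0) +
  ((1 - r) * w * ((r - 0) * b) - r * ((1 - r) * w * d)) =
  (r * w * (1 - r)) * (b - (a + d)) by rewrite /=; ring.
by rewrite mulr_ge0 ?mulr_ge0// subr_ge0.
Qed.

End ProductWeight.

(** * Exponential tilt of the excess of closed edges *)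

Section ExponentialTilt.
Variable R : realType.
Implicit Types (x p th : R) (a b k : nat).

(** From exp y >= 1 + y one gets (1 + x) exp(2x^2 - x) >= (1 + x)(1 + 2x^2 - x) = 1 + x^2 (1 + 2x)
    >= 1. *)
Lemma expR_le1D x : - 2^-1 <= x -> expR (x - 2 * x ^+ 2) <= 1 + x.
Proof.
move=> hx; have x1 : 0 < 1 + x by lra.
rewrite (_ : x - 2 * x ^+ 2 = - (2 * x ^+ 2 - x)); last by ring.
rewrite expRN -div1r ler_pdivrMr ?expR_gt0//.
have := expR_ge1Dx (2 * x ^+ 2 - x).
rewrite -(ler_pM2l x1) => /(le_trans _); apply.
have -> : (1 + x) * (1 + (2 * x ^+ 2 - x)) = 1 + x ^+ 2 * (1 + 2 * x) by ring.
by rewrite lerDl mulr_ge0 ?sqr_ge0//; lra.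
Qed.

(** [expR_le1D] is used at - th (1 - p) for each of [a] open edges and at th p for each of [b]
    closed ones; both squares are at most th^2. *)
Lemma expR_le_tilt p th a b : 0 <= p <= 1 -> 0 < th <= 2^-1 ->
  expR (th * (p * b%:R - (1 - p) * a%:R) - 2 * th ^+ 2 * (a + b)%:R) <=
  (1 - th * (1 - p)) ^+ a * (1 + th * p) ^+ b.
Proof.
move=> /andP[p0 p1] /andP[th0 th1].
have hq : 0 <= th * (1 - p) <= 2^-1 by nra.
have hp : 0 <= th * p by nra.
have le2 x : x ^+ 2 <= th ^+ 2 -> x - 2 * th ^+ 2 <= x - 2 * x ^+ 2 by lra.
apply: (@le_trans _ _ (expR (- (th * (1 - p)) - 2 * th ^+ 2) ^+ a *
                       expR (th * p - 2 * th ^+ 2) ^+ b)).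
  rewrite -!expRM_natl -expRD ler_expR natrD le_eqVlt; apply/orP; left.
  by apply/eqP; ring.
apply: ler_pM; rewrite ?exprn_ge0 ?expR_ge0//.
  apply: lerXn2r; rewrite ?nnegrE ?expR_ge0//; first by nra.
  apply: le_trans (expR_le1D _); last by lra.
  by rewrite ler_expR; apply: le2; nra.
apply: lerXn2r; rewrite ?nnegrE ?expR_ge0//; first by nra.
apply: le_trans (expR_le1D _); last by lra.
by rewrite ler_expR; apply: le2; nra.
Qed.

(** If N <= k or Y <= 4 th N, the first two terms suffice. Otherwise 2 th^2 N <= th Y / 2, so M >=
    exp(th Y / 2) >= (1 + th Y / 4)^2 >= th^2 Y^2 / 16, and bounding one factor Y below by 4 th k
    leaves a bound linear in Y. *)
Lemma deficit_le p th a b k : 0 <= p <= 1 -> 0 < th <= 2^-1 -> (0 < k)%N ->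
  p * b%:R - (1 - p) * a%:R <= k%:R + 4 * th * (a + b)%:R +
    4 / (th ^+ 3 * k%:R) * ((1 - th * (1 - p)) ^+ a * (1 + th * p) ^+ b).
Proof.
move=> p01 th01 k0; have := expR_le_tilt a b p01 th01.
move: p01 th01 => /andP[p0 p1] /andP[th0 th1].
set Y := p * b%:R - (1 - p) * a%:R; set N := (a + b)%:R.
set M := _ ^+ a * _ => YM.
have k0' : 0 < k%:R :> R by rewrite ltr0n.
have M0 : 0 <= M by apply: le_trans YM; exact: expR_ge0.
have N0 : 0 <= N :> R by rewrite /N.
have YN : Y <= N.
  rewrite /Y /N natrD; have : 0 <= a%:R :> R by [].
  have : 0 <= b%:R :> R by []. nra.
have cM0 : 0 <= 4 / (th ^+ 3 * k%:R) * M.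
  by rewrite mulr_ge0// divr_ge0// mulr_ge0// exprn_ge0// ltW.
have thN0 : 0 <= 4 * th * N by rewrite !mulr_ge0// ltW.
have [Nk|kN] := leP N k%:R; first by lra.
have [Yth|thY] := leP Y (4 * th * N); first by lra.
suff : Y <= 4 / (th ^+ 3 * k%:R) * M by lra.
have kthY : 4 * th * k%:R < Y by nra.
have Y0 : 0 < Y by apply: lt_trans kthY; rewrite !mulr_gt0.
have {YM} : (1 + th * Y / 4) ^+ 2 <= M.
  apply: le_trans YM.
  apply: (@le_trans _ _ (expR (th * Y / 4) ^+ 2)).
    apply: lerXn2r; rewrite ?nnegrE ?expR_ge0 ?expR_ge1Dx//.
    by rewrite addr_ge0// divr_ge0// mulr_ge0// ltW.
  rewrite -expRM_natl ler_expR.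
  have : 2 * th ^+ 2 * N <= th * Y / 2 by nra.
  by move: (2 * th ^+ 2 * N) => z; lra.
move=> YM; rewrite mulrAC ler_pdivlMr; last by rewrite mulr_gt0// exprn_gt0.
have : th ^+ 2 * Y ^+ 2 / 16 <= M.
  apply: le_trans YM; have : 0 <= th * Y by rewrite mulr_ge0// ltW.
  by nra.
rewrite -(@ler_pM2l _ 4)//; apply: le_trans.
have -> : Y * (th ^+ 3 * k%:R) = (th ^+ 2 * Y) * (4 * th * k%:R) / 4 by field.
have -> : 4 * (th ^+ 2 * Y ^+ 2 / 16) = (th ^+ 2 * Y) * Y / 4 by field.
by rewrite ler_pM2r// ler_wpM2l ?ltW// mulr_gt0// exprn_gt0.
Qed.

End ExponentialTilt.

(** * Resampling finitely many edges *)

Section ResampledEdges.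
Variables (T : choiceType) (H : graph T) (I : finType) (a b : I -> T).
Hypothesis ab : forall i, adj H (a i) (b i).
Let e i : set T := [set a i; b i].
Hypothesis e_inj : injective e.
Implicit Types (c : set (set T)) (s t : {ffun I -> bool}) (i : I).

(** With random [s] this separates the chosen edges from the rest of the configuration: inequalities
    are proved on the finite coin space for each frozen [c] and averaged over [c] afterwards. *)
Definition reset s c : set (set T) :=
  [set f | (exists2 i, f = e i & s i) \/ (c f /\ forall i, f <> e i)].

Definition ends : seq T := codom a ++ codom b.

Lemma reset_edge s c i : reset s c (e i) <-> s i.
Proof.
split=> [[[j /e_inj ->//]|[_ /(_ i)//]]|si]; left.
by exists i.
Qed.

Lemma size_ends : size ends = (2 * #|I|)%N.
Proof. by rewrite size_cat !size_codom mul2n addnn. Qed.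

Lemma a_ends i : a i \in ends.
Proof. by rewrite mem_cat codom_f. Qed.

Lemma b_ends i : b i \in ends.
Proof. by rewrite mem_cat codom_f orbT. Qed.

Definition touch (C : set T) i : bool := `[< C (a i) \/ C (b i) >].

Definition revealed c u s : {set I} :=
  [set i | touch (pcluster H (reset s c) u) i].

(** Changing bits off [revealed] affects no edge with an end in the cluster, so the exploration from
    [u] runs as before. This makes [revealed] a stopping set as required by [sum_weight_stop]. *)
Lemma pcluster_reset_stop c u s t :
    (forall i, i \in revealed c u s -> t i = s i) ->
  pcluster H (reset t c) u = pcluster H (reset s c) u.
Proof.
move=> st; apply/esym/pcluster_stop => y z uy yz; split=> -[[i yzi si]|];
  (try by right); left; exists i => //; move: si; rewrite st// inE;
  apply/asboolP; have : e i y by [rewrite -yzi; left];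
  by move=> [<-|<-]; [left|right].
Qed.

Definition ntouch c i s : nat :=
  count (touch^~ i) (infclusters H (reset s c) ends).

Lemma touch_infclusters s c i C : C \in infclusters H (reset s c) ends ->
  touch C i -> C = pcluster H (reset s c) (a i) \/
               C = pcluster H (reset s c) (b i).
Proof.
move=> /mem_infclusters[u _ [_ ->]] /asboolP[/pcluster_eqP|/pcluster_eqP];
  by [left|right].
Qed.

Lemma ntouch_le2 c i s : (ntouch c i s <= 2)%N.
Proof.
rewrite /ntouch -size_filter.
apply: (@uniq_leq_size _ _ [:: pcluster H (reset s c) (a i);
                               pcluster H (reset s c) (b i)]).
  by rewrite filter_uniq// undup_uniq.
move=> C; rewrite mem_filter => /andP[iC CC]; rewrite !inE.
by have [->|->] := touch_infclusters CC iC; rewrite eqxx ?orbT.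
Qed.

Lemma ntouch_ge (Cs : seq (set T)) c i s : uniq Cs ->
    (forall C, C \in Cs -> infinite_set C /\
      (C = pcluster H (reset s c) (a i) \/ C = pcluster H (reset s c) (b i))) ->
  (size Cs <= ntouch c i s)%N.
Proof.
move=> uCs CsP; rewrite /ntouch -size_filter; apply: uniq_leq_size => // C.
move=> /CsP[iC CE]; rewrite mem_filter; apply/andP; split.
  by apply/asboolP; case: CE => ->; [left|right]; exact: pcluster_refl.
apply/mem_infclusters; case: CE => CE; rewrite {}CE in iC *.
  by exists (a i) => //; exact: a_ends.
by exists (b i) => //; exact: b_ends.
Qed.

(** An open edge touches at most one infinite cluster, while a closed separating edge touches two.
    If the open edge touches one, closing it splits that cluster into at most two pieces, one of
    which is infinite. *)
Lemma ntouch_flip c i s :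
  (ntouch c i (setbit i true s) +
   `[< infsep H (reset (setbit i false s) c) (a i) (b i) >] <=
   ntouch c i (setbit i false s))%N.
Proof.
set sT := setbit i true s; set sF := setbit i false s.
have abT : pcluster H (reset sT c) (a i) = pcluster H (reset sT c) (b i).
  apply/pcluster_eqP/pcluster_adj => //.
  by apply/reset_edge; rewrite ffunE eqxx.
have T1 : (ntouch c i sT <= 1)%N.
  rewrite /ntouch -size_filter.
  apply: (@uniq_leq_size _ _ [:: pcluster H (reset sT c) (a i)]).
    by rewrite filter_uniq// undup_uniq.
  move=> C; rewrite mem_filter => /andP[iC CC]; rewrite inE abT.
  by have [->|->] := touch_infclusters CC iC; rewrite -?abT ?eqxx.
case: asboolP => [[ia ib nab]|_].
  apply: (@leq_trans 2); first by rewrite /= addn1 ltnS T1.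
  apply: (@ntouch_ge [:: pcluster H (reset sF c) (a i);
                         pcluster H (reset sF c) (b i)]).
    by rewrite /= inE andbT; apply/negP => /eqP/pcluster_eqP.
  by move=> C; rewrite !inE => /orP[] /eqP ->; split=> //; [left|right].
rewrite addn0; move: T1; rewrite leq_eqVlt ltnS leqn0.
case/orP => /eqP T1; rewrite T1//.
have [iF|niF] := pselect (inf_cluster H (reset sF c) (a i)).
  apply: (@ntouch_ge [:: pcluster H (reset sF c) (a i)]) => // C.
  by rewrite inE => /eqP ->; split=> //; left.
have [iF|niF'] := pselect (inf_cluster H (reset sF c) (b i)).
  apply: (@ntouch_ge [:: pcluster H (reset sF c) (b i)]) => // C.
  by rewrite inE => /eqP ->; split=> //; right.
exfalso; have : inf_cluster H (reset sT c) (a i).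
  have : has (touch^~ i) (infclusters H (reset sT c) ends).
    by rewrite has_count -/(ntouch c i sT) T1.
  move=> /hasP[C CC iC]; have [u _ [iu Cu]] := mem_infclusters _ _ _ _ CC.
  by have [|] := touch_infclusters CC iC; rewrite -?abT /inf_cluster => <-;
    rewrite Cu.
apply; apply: (@sub_finite_set _ _ (pcluster H (reset sF c) (a i) `|`
    pcluster H (reset sF c) (b i))); last first.
  by rewrite finite_setU; split; exact: contrapT.
apply: (@subset_trans _ (pcluster H (reset sF c `|` [set e i]) (a i))).
  apply: pcluster_mono => f [[j -> sj]|[cf nf]].
    have [->|ji] := eqVneq j i; first by right.
    by left; left; exists j => //; move: sj; rewrite !ffunE (negbTE ji).
  by left; right.
by move=> y /(@pcluster_add _ H _ (a i) (b i))[[|]|]; [left|left|right].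
Qed.

End ResampledEdges.

Lemma sum_undup_le (R : realFieldType) (X : eqType) (L : seq X) (F : X -> R) :
  (forall x, 0 <= F x) -> \sum_(x <- undup L) F x <= \sum_(x <- L) F x.
Proof.
move=> F0; elim: L => //= x L IH; rewrite big_cons; case: ifP => _.
  by rewrite (le_trans IH)// lerDr.
by rewrite big_cons lerD2l.
Qed.

(** * The main estimate with all but the chosen edges frozen *)

Section AveragedCount.
Variables (R : realType) (p : R).
Hypothesis p01 : 0 <= p <= 1.
Variables (T : choiceType) (H : graph T) (I : finType) (a b : I -> T).
Hypothesis ab : forall i, adj H (a i) (b i).
Let e i : set T := [set a i; b i].
Hypothesis e_inj : injective e.
Implicit Types (c : set (set T)) (s t : {ffun I -> bool}) (i : I).

Definition bern (x : bool) : R := if x then p else 1 - p.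

Lemma bern_ge0 x : 0 <= bern x.
Proof. by have /andP[p0 p1] := p01; case: x; rewrite /bern ?subr_ge0. Qed.

Lemma bern_sum : bern true + bern false = 1.
Proof. by rewrite /bern; ring. Qed.

Let sep c s i : R := (`[< infsep H (reset a b s c) (a i) (b i) >] : nat)%:R.
(** A factor of mean one under [bern] that favours closed edges when th > 0. *)
Let tilt (th : R) (x : bool) : R := if x then 1 - th * (1 - p) else 1 + th * p.

Let tilt_ge0 th x : 0 < th <= 2^-1 -> 0 <= tilt th x.
Proof.
by have /andP[p0 p1] := p01; move=> /andP[h0 h1]; case: x; rewrite /tilt; nra.
Qed.

(** Each edge is flipped on its own by [sum_weight_flip], with [ntouch] as the count and the
    separation indicator as its drop. Regrouping the pairs (edge, touched cluster) by cluster yields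
    the deficits on the right. *)
Lemma sep_le_deficit c :
  p * \sum_s weight bern s * \sum_i sep c s i <=
  \sum_s weight bern s *
    \sum_(C <- infclusters H (reset a b s c) (ends a b))
      \sum_(i | touch a b C i) (p - (s i)%:R).
Proof.
rewrite (eq_bigr (fun s => \sum_i weight bern s * sep c s i)); last first.
  by move=> s _; rewrite mulr_sumr.
rewrite exchange_big mulr_sumr /=.
rewrite [leRHS](eq_bigr (fun s => \sum_i weight bern s *
    ((p - (s i)%:R) * (ntouch H a b c i s)%:R))); last first.
  move=> s _; rewrite (exchange_big_dep predT)//= mulr_sumr.
  apply: eq_bigr => i _; congr (_ * _).
  by rewrite big_const_seq iter_addr_0 -[LHS]mulr_natr.
rewrite [leRHS]exchange_big /=; apply: ler_sum => i _.
apply: (@sum_weight_flip R I bern i (fun s => (ntouch H a b c i s)%:R)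
  (fun s => sep c s i)) => [x||s|s].
- exact: bern_ge0.
- exact: bern_sum.
- rewrite /sep; case: asboolP => //= -[_ _ []].
  apply: pcluster_adj => //; apply/(reset_edge e_inj).
  by rewrite ffunE eqxx.
- by rewrite /sep -natrD ler_nat; exact: ntouch_flip.
Qed.

Lemma deficit_set_le (J : {set I}) s th (k : nat) :
    0 < th <= 2^-1 -> (0 < k)%N ->
  \sum_(i in J) (p - (s i)%:R) <= k%:R + 4 * th * #|J|%:R +
    4 / (th ^+ 3 * k%:R) * \prod_(i in J) tilt th (s i).
Proof.
move=> th01 k0.
pose n1 := #|[set i in J | s i]|; pose n0 := #|[set i in J | ~~ s i]|.
have J1 i : (i \in J) && s i = (i \in [set j in J | s j]) by rewrite inE.
have J0 i : (i \in J) && ~~ s i = (i \in [set j in J | ~~ s j]) by rewrite inE.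
have -> : #|J| = (n1 + n0)%N.
  rewrite /n1 /n0 -!sum1_card (bigID s)/=.
  by congr (_ + _)%N; apply: eq_bigl.
have -> : \sum_(i in J) (p - (s i)%:R) = p * n0%:R - (1 - p) * n1%:R.
  rewrite (bigID s)/= (eq_bigr (fun=> p - 1)) => [|i /andP[_ ->]//].
  rewrite [X in _ + X](eq_bigr (fun=> p)) => [|i /andP[_ /negbTE ->]]; last first.
    by rewrite subr0.
  rewrite (eq_bigl _ _ J1) (eq_bigl _ _ J0) !sumr_const.
  rewrite -[(p - 1) *+ _]mulr_natr -[p *+ _]mulr_natr.
  by rewrite -/n0 -/n1; ring.
have -> : \prod_(i in J) tilt th (s i) =
    (1 - th * (1 - p)) ^+ n1 * (1 + th * p) ^+ n0.
  rewrite (bigID s)/= (eq_bigr (fun=> tilt th true)) => [|i /andP[_ ->]//].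
  rewrite [X in _ * X](eq_bigr (fun=> tilt th false)) => [|i /andP[_ /negbTE ->]//].
  by rewrite (eq_bigl _ _ J1) (eq_bigl _ _ J0) !prodr_const.
exact: deficit_le.
Qed.

(** Each cluster's deficit is bounded by [deficit_set_le]: the constant k is paid once per cluster,
    the linear term at most twice per edge, and the tilt term has mean one for each of the 2 #|I|
    ends by [sum_weight_stop]. *)
Lemma averaged_count c th (k : nat) : 0 < th <= 2^-1 -> (0 < k)%N ->
  p * \sum_s weight bern s * \sum_i sep c s i <=
  k%:R * \sum_s weight bern s * (nclusters H (reset a b s c) (ends a b))%:R +
  (8 * th + 8 / (th ^+ 3 * k%:R)) * #|I|%:R.
Proof.
move=> th01 k0; have th0 : 0 < th by case/andP: th01.
set Q := 4 / (th ^+ 3 * k%:R).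
have Q0 : 0 <= Q by rewrite divr_ge0// mulr_ge0// exprn_ge0// ltW.
pose clus s := infclusters H (reset a b s c) (ends a b).
pose M s (C : set T) := \prod_(i | touch a b C i) tilt th (s i).
have M0 s C : 0 <= M s C by apply: prodr_ge0 => i _; exact: tilt_ge0.
apply: le_trans (sep_le_deficit c) _.
have step s : \sum_(C <- clus s) \sum_(i | touch a b C i) (p - (s i)%:R) <=
    k%:R * (nclusters H (reset a b s c) (ends a b))%:R + 8 * th * #|I|%:R +
    Q * \sum_(u <- ends a b) M s (pcluster H (reset a b s c) u).
  apply: (@le_trans _ _ (\sum_(C <- clus s) (k%:R +
      4 * th * (\sum_(i | touch a b C i) 1) + Q * M s C))).
    apply: ler_sum => C _.
    have E i : (i \in finset (touch a b C)) = touch a b C i by rewrite inE.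
    have := @deficit_set_le (finset (touch a b C)) s th k th01 k0.
    by rewrite -sum1_card natr_sum !(eq_bigl _ _ E).
  rewrite !big_split /= -!mulr_sumr lerD//.
    rewrite lerD//.
      by rewrite big_const_seq count_predT iter_addr_0 mulr_natr.
    rewrite (_ : 8 * th * _ = 4 * th * (2 * #|I|%:R)); last by ring.
    apply: ler_wpM2l; first by rewrite mulr_ge0// ltW.
    rewrite (exchange_big_dep predT)//=.
    apply: (@le_trans _ _ (\sum_(i : I) 2%:R)); last first.
      by rewrite sumr_const -[leLHS]mulr_natr.
    apply: ler_sum => i _; rewrite big_const_seq iter_addr_0 ler_nat.
    exact: ntouch_le2.
  apply: ler_wpM2l => //.
  (* The sum is enlarged to the clusters of all ends, with repetition, because the stopping identity
     concerns the cluster of a fixed vertex. *)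
  apply: le_trans (sum_undup_le _ (M0 s)) _.
  rewrite big_map big_filter big_mkcond; apply: ler_sum => u _.
  by case: ifP.
have -> : k%:R * (\sum_s weight bern s *
      (nclusters H (reset a b s c) (ends a b))%:R) +
    (8 * th + 8 / (th ^+ 3 * k%:R)) * #|I|%:R =
    \sum_s weight bern s *
      (k%:R * (nclusters H (reset a b s c) (ends a b))%:R + 8 * th * #|I|%:R +
       Q * \sum_(u <- ends a b) M s (pcluster H (reset a b s c) u)).
  under [RHS]eq_bigr do rewrite !mulrDr.
  rewrite !big_split /= -mulr_suml (sum_weight _ bern_sum) mul1r.
  rewrite [X in _ = _ + X](_ : _ = Q * (2 * #|I|%:R)).
    rewrite mulr_sumr [X in _ = X + _ + _](eq_bigr (fun s => k%:R *
      (weight bern s * (nclusters H (reset a b s c) (ends a b))%:R))).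
      by rewrite /Q; field; rewrite !gt_eqF ?ltr0n.
    by move=> s _; rewrite mulrCA.
  under eq_bigr do rewrite mulrCA mulr_sumr.
  rewrite -mulr_sumr exchange_big /= (eq_bigr (fun=> 1)).
    by rewrite big_const_seq iter_addr_0 count_predT size_ends natrM.
  move=> u _; rewrite -[RHS](@sum_weight_stop R I (revealed H a b c u) bern
    (tilt th)).
  - apply: eq_bigr => s _; congr (_ * _); rewrite /M; apply: eq_bigl => i.
    by rewrite inE.
  - by move=> s t /pcluster_reset_stop st; apply/setP => i; rewrite !inE st.
  - exact: bern_sum.
  - by rewrite /bern /tilt; ring.
apply: ler_sum => s _; apply: ler_wpM2l (step s).
by apply: weight_ge0; exact: bern_ge0.
Qed.

End AveragedCount.

(** * The law of the configuration *)

Section Configurations.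
Variables (X : countType) (H : graph X).

Definition cylinder (J : {fset set X}) : set (set (set X)) :=
  [set c | forall e, e \in J -> c e].

(** Events that finitely many edges are open form a pi-system, so they determine the law.
    Restricting to edges of [H] matches the fact that the percolation law constrains only those. *)
Definition cylinders : set (set (set (set X))) :=
  [set cylinder J | J in [set J : {fset set X} | [set` J] `<=` edges H]].

Definition config := g_sigma_algebraType cylinders.

Lemma cylinderI (J K : {fset set X}) :
  cylinder J `&` cylinder K = cylinder (J `|` K)%fset.
Proof.
apply/seteqP; split=> c.
  by move=> [cJ cK] e; rewrite inE => /orP[/cJ|/cK].
by move=> cJK; split=> e eJ; apply: cJK; rewrite inE eJ ?orbT.
Qed.

Lemma setI_closed_cylinders : setI_closed cylinders.
Proof.
move=> _ _ [J JH <-] [K KH <-].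
exists (J `|` K)%fset; last by rewrite cylinderI.
by move=> e /=; rewrite inE => /orP[/JH|/KH].
Qed.

Lemma measurable_cylinder (J : {fset set X}) : [set` J] `<=` edges H ->
  measurable (cylinder J : set config).
Proof. by move=> JH; apply: sub_sigma_algebra; exists J. Qed.

Lemma measurable_open e : edges H e -> measurable ([set c | c e] : set config).
Proof.
move=> He; have -> : [set c | c e] = cylinder [fset e]%fset.
  apply/seteqP; split=> c /=; first by move=> ce f; rewrite inE => /eqP ->.
  by apply; rewrite inE.
by apply: measurable_cylinder => f /=; rewrite inE => /eqP ->.
Qed.

Lemma measurable_bigcupT (Y : countType) (F : Y -> set config) :
  (forall y, measurable (F y)) -> measurable (\bigcup_y F y).
Proof. exact/countable_bigcupT_measurable. Qed.

(** Open walks sorted by length make connection a countable union of events, each measurable by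
    induction. *)
Fixpoint steps n c x y : Prop :=
  if n is m.+1 then exists z, steps m c x z /\ adj H z y /\ c [set z; y]
  else x = y.

Lemma steps_pcluster c x y : pcluster H c x y <-> exists n, steps n c x y.
Proof.
split=> [xy|[n]].
  elim: (clos_rt_rtn1 _ _ _ _ xy) => [|u v [uv cuv] _ [n xu]].
    by exists 0%N.
  by exists n.+1, u.
elim: n y => [y <-|n IH y [z [/IH xz [zy czy]]]]; first exact: pcluster_refl.
exact: pcluster_trans xz (pcluster_adj zy czy).
Qed.

Lemma measurable_pcluster x y :
  measurable ([set c | pcluster H c x y] : set config).
Proof.
have -> : [set c | pcluster H c x y] = \bigcup_n [set c | steps n c x y].
  by apply/seteqP; split=> c /= => [/steps_pcluster[n]|[n _]] ?;
    [exists n|apply/steps_pcluster; exists n].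
apply: measurable_bigcupT => n; elim: n y => [|n IH] y.
  have [->|xy] := pselect (x = y).
    by rewrite (_ : [set _ | _] = setT)//; apply/seteqP; split.
  by rewrite (_ : [set _ | _] = set0)//; apply/seteqP; split.
have -> : [set c | steps n.+1 c x y] =
    \bigcup_z ([set c | steps n c x z] `&` [set c | adj H z y /\ c [set z; y]]).
  apply/seteqP; split=> c /= [z]; first by move=> [h1 h2]; exists z.
  by move=> _ [h1 h2]; exists z.
apply: measurable_bigcupT => z; apply: measurableI => //.
have [zy|nzy] := pselect (adj H z y); last first.
  by rewrite (_ : [set _ | _] = set0)//; apply/seteqP; split=> // c [].
rewrite (_ : [set _ | _] = [set c | c [set z; y]]).
  by apply: measurable_open; exists z, y.
by apply/seteqP; split=> c //= [].
Qed.

(** Infiniteness as unboundedness of codes is a countable intersection of countable unions, hence a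
    measurable condition. *)
Lemma infinite_pickleP (A : set X) :
  infinite_set A <-> forall n, exists y, (n <= choice.pickle y)%N /\ A y.
Proof.
split=> [iA n|hA finA].
  apply: contra_notP iA => nex.
  apply: (@sub_finite_set _ _ [set y : X | (choice.pickle y < n)%N]).
    move=> y Ay /=; rewrite ltnNge; apply/negP => ny.
    by apply: nex; exists y.
  rewrite -[X in finite_set X]/(choice.pickle @^-1` `I_n).
  by apply: finite_preimage => // y z _ _; exact: (pcan_inj choice.pickleK).
have [M MA] : exists M, forall y, A y -> (choice.pickle y < M)%N.
  have /finite_seqP[s As] := finA.
  exists (\max_(y <- s) (choice.pickle y).+1)%N => y; rewrite As /= => ys.
  exact: (@leq_bigmax_seq _ _ xpredT (fun y : X => (choice.pickle y).+1) y ys).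
by have [y [My /MA]] := hA M; rewrite ltnNge My.
Qed.

Lemma measurable_inf_cluster x :
  measurable ([set c | inf_cluster H c x] : set config).
Proof.
have -> : [set c | inf_cluster H c x] = \bigcap_n \bigcup_y
    ([set c | (n <= choice.pickle y)%N] `&` [set c | pcluster H c x y]).
  apply/seteqP; split=> c /=.
    move=> /infinite_pickleP ic n _; have [y [ny xy]] := ic n.
    by exists y.
  move=> ic; apply/infinite_pickleP => n; have [//|y _ [ny xy]] := ic n.
  by exists y.
apply: bigcap_measurableType => n _; apply: measurable_bigcupT => y.
apply: measurableI; last exact: measurable_pcluster.
case: (leqP n (choice.pickle y)) => _.
  by rewrite (_ : [set _ | _] = setT)//; apply/seteqP; split.
by rewrite (_ : [set _ | _] = set0)//; apply/seteqP; split.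
Qed.

Definition sepset x y : set config := [set c | infsep H c x y].

Lemma measurable_sepset x y : measurable (sepset x y).
Proof.
have -> : sepset x y =
    [set c | inf_cluster H c x] `&` [set c | inf_cluster H c y] `&`
    ~` [set c | pcluster H c x y].
  by apply/seteqP; split=> c /= => [[? ? ?]|[[? ?] ?]].
apply: measurableI; first by apply: measurableI; exact: measurable_inf_cluster.
by apply: measurableC; exact: measurable_pcluster.
Qed.

Definition newset u (U : seq X) : set config := [set c | newcluster H c u U].

Lemma measurable_newset u U : measurable (newset u U).
Proof.
have -> : newset u U = [set c | inf_cluster H c u] `&`
    \bigcap_(v in [set` U]) ~` [set c | pcluster H c u v].
  by apply/seteqP; split=> c /= => [[? h]|[? h]]; split=> // v /h.
apply: measurableI; first exact: measurable_inf_cluster.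
apply: fin_bigcap_measurable => //= v _.
by apply: measurableC; exact: measurable_pcluster.
Qed.

(** Given inductively so that integrability and the transfer of expectations need checking only on
    indicators, sums and multiples. *)
Inductive simple (R : realType) : (config -> R) -> Prop :=
| simple_indic E : measurable E -> simple (\1_E)
| simpleD f g : simple f -> simple g -> simple (fun c => f c + g c)
| simpleZ k f : simple f -> simple (fun c => k * f c).

Lemma simple_cst (R : realType) (k : R) : simple (fun=> k).
Proof.
have := simpleZ k (simple_indic R (@measurableT _ config)).
by under eq_fun do rewrite indicT mulr1.
Qed.

Lemma simple_sum (R : realType) (I : Type) (r : seq I) (f : I -> config -> R) :
  (forall i, simple (f i)) -> simple (fun c => \sum_(i <- r) f i c).
Proof.
move=> sf; elim: r => [|i r IH].
  by under eq_fun do rewrite big_nil; exact: simple_cst.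
by under eq_fun do rewrite big_cons; exact: simpleD.
Qed.

Lemma simple_asbool (R : realType) (Q : config -> Prop) : measurable Q ->
  simple (fun c => (`[< Q c >] : nat)%:R : R).
Proof.
move=> mQ; have := simple_indic R mQ.
congr simple; apply/funext => c; rewrite indicE; congr ((_ : bool)%:R).
Qed.

Definition count_inf (R : realType) U (c : config) : R := (nclusters H c U)%:R.

Lemma simple_count (R : realType) U : simple (count_inf R U).
Proof.
elim: U => [|u U IH]; first exact: simple_cst.
have -> : count_inf R (u :: U) =
    fun c => (`[< newset u U c >] : nat)%:R + count_inf R U c.
  by apply/funext => c; rewrite /count_inf nclusters_cons natrD.
by apply: simpleD => //; apply: simple_asbool; exact: measurable_newset.
Qed.

End Configurations.
Arguments sepset {X} H x y.
Arguments count_inf {X} H R U c.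

Section Law.
Variables (X : countType) (H : graph X).
Variables (R : realType) (p : R).
Variables (d : measure_display) (T : measurableType d) (P : probability T R).
Variable omega : T -> set (set X).
Hypothesis perc : bernoulli_percolation P H p omega.
Implicit Types E F : set (config H).

Lemma omega_measurable (E : set (config H)) : measurable E ->
  measurable (omega @^-1` E).
Proof.
move=> mE; rewrite -[_ @^-1` _]setTI.
suff : measurable_fun setT (omega : T -> config H) by apply.
apply: (@measurability _ _ T (config H) setT omega (cylinders H)) => //.
move=> _ [_ [J JH <-] <-]; rewrite setTI.
have -> : omega @^-1` cylinder J = \bigcap_(e in [set` J]) [set w | omega w e].
  by apply/seteqP; split.
apply: fin_bigcap_measurable => // e /JH.
by case: perc => + _ _; exact.
Qed.

Definition config_prob (E : set (config H)) : R := fine (P (omega @^-1` E)).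

Local Notation pr := config_prob.

Lemma prE E : measurable E -> P (omega @^-1` E) = (pr E)%:E.
Proof.
move=> mE; rewrite /config_prob fineK// fin_num_measure//.
exact: omega_measurable.
Qed.

Lemma pr_ge0 E : 0 <= pr E. Proof. exact: fine_ge0. Qed.

Lemma pr_le E F : measurable E -> measurable F -> E `<=` F -> pr E <= pr F.
Proof.
move=> mE mF EF; rewrite -lee_fin -!prE// le_measure ?inE//.
- exact: omega_measurable.
- exact: omega_measurable.
- by move=> w; exact: EF.
Qed.

Lemma prU_le E F : measurable E -> measurable F ->
  pr (E `|` F) <= pr E + pr F.
Proof.
move=> mE mF; rewrite -lee_fin EFinD -!prE//; last exact: measurableU.
by rewrite preimage_setU measureU2//; exact: omega_measurable.
Qed.

Lemma pr_cylinder (J : {fset set X}) : [set` J] `<=` edges H ->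
  pr (cylinder J) = p ^+ #|` J|.
Proof.
move=> JH; apply: EFin_inj; rewrite -prE; last exact: measurable_cylinder.
have -> : omega @^-1` cylinder J = \bigcap_(e in [set` J]) [set w | omega w e].
  by apply/seteqP; split.
case: perc => _ Pp indep; rewrite (indep _ JH) big_seq.
rewrite (eq_bigr (fun=> p%:E)) => [|e eJ]; last exact: Pp (JH _ eJ).
rewrite -big_seq big_const_seq count_predT.
by elim: (size _) => //= n ->; rewrite exprS EFinM.
Qed.

(** The events satisfying the conclusion form a Dynkin system containing the pi-system of cylinders.
    It serves resampling, with bit vectors for [K], and automorphisms, with [K] a single point. *)
Lemma pr_transfer (K : finType) (w : K -> R)
    (r : K -> set (set X) -> set (set X)) :
    (forall k, 0 <= w k) ->
    (forall (J : {fset set X}) k, [set` J] `<=` edges H ->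
      measurable (r k @^-1` cylinder J : set (config H))) ->
    (forall J : {fset set X}, [set` J] `<=` edges H ->
      pr (cylinder J) = \sum_k w k * pr (r k @^-1` cylinder J)) ->
  forall E : set (config H), measurable E ->
    (forall k, measurable (r k @^-1` E : set (config H))) /\
    pr E = \sum_k w k * pr (r k @^-1` E).
Proof.
move=> w0 mr prr.
pose D := [set E : set (config H) | [/\ measurable E,
  forall k, measurable (r k @^-1` E : set (config H)) &
  pr E = \sum_k w k * pr (r k @^-1` E)]].
suff : <<s cylinders H >> `<=` D by move=> sub E /sub[].
rewrite -(setI_closed_g_dynkin_g_sigma_algebra (@setI_closed_cylinders X H)).
have cylD : cylinders H `<=` D.
  move=> _ [J JH <-]; split; [exact: measurable_cylinder| |exact: prr].
  by move=> k; exact: mr.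
(* The whole space is the cylinder over no edges; the identity for it is used again for
   complements. *)
have DT : D setT.
  apply: cylD; exists fset0 => //.
  by apply/seteqP; split=> // c _ e; rewrite inE.
apply: smallest_sub => //; split=> //.
  move=> E [mE mrE prE']; split.
  - exact: measurableC.
  - by move=> k; rewrite preimage_setC; apply: measurableC; exact: mrE.
  - have prC F : measurable F -> pr (~` F) = pr setT - pr F.
      move=> mF; have mCF := measurableC mF.
      apply: EFin_inj; rewrite EFinB -!prE//.
      rewrite preimage_setC probability_setC; last exact: omega_measurable.
      by rewrite preimage_setT probability_setT.
    rewrite prC// prE'; case: DT => _ _ ->; rewrite -sumrB.
    apply: eq_bigr => k _; rewrite -mulrBr preimage_setT preimage_setC prC//.
    exact: mrE.
move=> F tF DF; have mF n : measurable (F n : set (config H)) by case: (DF n).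
have mrF n k : measurable (r k @^-1` F n : set (config H)) by case: (DF n).
split.
- exact: bigcupT_measurable.
- move=> k; rewrite preimage_bigcup; apply: bigcupT_measurable => n.
  exact: mrF.
have tpre (Y Z : Type) (f : Y -> Z) (G : nat -> set Z) :
    trivIset setT G -> trivIset setT (fun n => f @^-1` G n).
  by move=> tG i j _ _ [y [yi yj]]; apply: tG => //; exists (f y).
have prU G : (forall n, measurable (G n : set (config H))) -> trivIset setT G ->
    ((pr (\bigcup_n G n))%:E = \sum_(n <oo) (pr (G n))%:E)%E.
  move=> mG tG; rewrite -prE; last exact: bigcupT_measurable.
  rewrite preimage_bigcup measure_semi_bigcup.
  - by apply: eq_eseriesr => n _; exact: (prE (mG n)).
  - by move=> n; exact: omega_measurable.
  - exact: tpre.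
  - by apply: bigcupT_measurable => n; exact: omega_measurable.
apply: EFin_inj; rewrite prU// -sumEFin.
rewrite (eq_eseriesr (g := fun n =>
  (\sum_k (w k)%:E * (pr (r k @^-1` F n))%:E)%E)); last first.
  move=> n _; case: (DF n) => _ _ ->; rewrite -sumEFin.
  by apply: eq_bigr => k _; rewrite EFinM.
rewrite nneseries_sum; last first.
  by move=> k n _; rewrite -EFinM lee_fin mulr_ge0// pr_ge0.
apply: eq_bigr => k _; rewrite nneseriesZl; last first.
  by move=> n _; rewrite lee_fin pr_ge0.
by rewrite EFinM preimage_bigcup prU//; exact: tpre.
Qed.

End Law.

(** * Expectations under resampling *)

Section Expectation.
Variables (X : countType) (H : graph X).
Variables (R : realType) (p : R) (p01 : 0 <= p <= 1).
Variables (d : measure_display) (T : measurableType d) (P : probability T R).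
Variable omega : T -> set (set X).
Hypothesis perc : bernoulli_percolation P H p omega.
Implicit Types (E F : set (config H)) (f g : config H -> R).

Local Notation pr := (@config_prob X H R d T P omega).

Definition config_expect f : R := \int[P]_t f (omega t).

Local Notation expect := config_expect.

Lemma indic_omega E : (fun t => \1_E (omega t) : R) = \1_(omega @^-1` E).
Proof. by apply/funext => t; rewrite !indicE. Qed.

Lemma simple_integrable f : simple f ->
  P.-integrable setT (EFin \o (fun t => f (omega t))).
Proof.
elim=> [E mE|{}f g _ IHf _ IHg|k {}f _ IH].
- rewrite indic_omega; apply: integrable_indic.
  exact: (omega_measurable perc).
- exact: (@integrableD _ _ _ P setT measurableT _ _ IHf IHg).
- exact: (@integrableZl _ _ _ P setT measurableT k _ IH).
Qed.

Lemma expect_indic E : measurable E -> expect \1_E = pr E.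
Proof.
move=> mE; rewrite /config_expect indic_omega /Rintegral.
rewrite integral_indic ?setIT//.
exact: (omega_measurable perc).
Qed.

Lemma expectD f g : simple f -> simple g ->
  expect (fun c => f c + g c) = expect f + expect g.
Proof.
by move=> sf sg; rewrite /config_expect RintegralD//; exact: simple_integrable.
Qed.

Lemma expectZ k f : simple f -> expect (fun c => k * f c) = k * expect f.
Proof.
by move=> sf; rewrite /config_expect RintegralZl//; exact: simple_integrable.
Qed.

Lemma expect_le f g : simple f -> simple g -> (forall c, f c <= g c) ->
  expect f <= expect g.
Proof.
move=> sf sg fg; apply: le_Rintegral => //; exact: simple_integrable.
Qed.

Lemma expect_cst k : expect (fun=> k) = k.
Proof.
rewrite /config_expect Rintegral_cst//; transitivity (k * fine (1 : \bar R)).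
  by congr (_ * fine _); exact: probability_setT.
by rewrite mulr1.
Qed.

Lemma expect_sum (I : Type) (r : seq I) (f : I -> config H -> R) :
    (forall i, simple (f i)) ->
  expect (fun c => \sum_(i <- r) f i c) = \sum_(i <- r) expect (f i).
Proof.
move=> sf; elim: r => [|i r IH].
  rewrite big_nil -[RHS]expect_cst; congr expect; apply/funext => c.
  by rewrite big_nil.
rewrite big_cons -IH -expectD//; last exact: simple_sum.
by congr expect; apply/funext => c; rewrite big_cons.
Qed.

Lemma expect_asbool (Q : config H -> Prop) : measurable Q ->
  expect (fun c => (`[< Q c >] : nat)%:R) = pr Q.
Proof.
move=> mQ; rewrite -expect_indic//; congr expect; apply/funext => c.
Qed.

Lemma expect_transfer (K : finType) (w : K -> R)
    (r : K -> set (set X) -> set (set X)) :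
    (forall E, measurable E ->
      (forall k, measurable (r k @^-1` E : set (config H))) /\
      pr E = \sum_k w k * pr (r k @^-1` E)) ->
  forall f, simple f -> (forall k, simple (fun c : config H => f (r k c))) /\
    expect f = \sum_k w k * expect (fun c => f (r k c)).
Proof.
move=> tr f; elim=> [E mE|{}f g sf [srf IHf] sg [srg IHg]|k {}f sf [srf IH]].
- have [mrE prEr] := tr E mE.
  have rE k : (fun c : config H => \1_E (r k c) : R) = \1_(r k @^-1` E).
    by apply/funext => c; rewrite !indicE.
  split=> [k|]; first by rewrite rE; exact: simple_indic.
  rewrite expect_indic// prEr; apply: eq_bigr => k _.
  by rewrite rE expect_indic.
- split=> [k|]; first exact: simpleD.
  rewrite expectD// IHf IHg -big_split /=; apply: eq_bigr => k _.
  by rewrite expectD// mulrDr.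
- split=> [j|]; first exact: simpleZ.
  rewrite expectZ// IH mulr_sumr; apply: eq_bigr => j _.
  by rewrite expectZ// mulrCA.
Qed.

Section Resampling.
Variables (I : finType) (a b : I -> X).
Hypothesis e_inj : injective (fun i => [set a i; b i]).
Let e i : set X := [set a i; b i].

Lemma reset_cylinder (J : {fset set X}) (s : {ffun I -> bool}) :
  reset a b s @^-1` cylinder J =
  if [forall i, (e i \in J) ==> s i]
  then cylinder (J `\` [fset e i | i in I])%fset else set0.
Proof.
case: forallP => [sJ|nsJ]; apply/seteqP; split=> // c.
- move=> cJ f; rewrite inE => /andP[/imfsetP nf fJ].
  have [[i fi _]|[]//] := cJ f fJ.
  by case: nf; exists i.
- move=> cJ f fJ.
  have [/imfsetP[i _ fi]|nf] := boolP (f \in [fset e i | i in I]%fset).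
    left; exists i => //; have := sJ i; rewrite /e -/(e i) -fi fJ; exact.
  right; split; first by apply: cJ; rewrite inE nf.
  by move=> i fi; move/imfsetP : nf; apply; exists i.
- move=> cJ; apply: nsJ => i; apply/implyP => /cJ.
  by move/(reset_edge e_inj).
Qed.

Lemma measurable_reset (J : {fset set X}) s : [set` J] `<=` edges H ->
  measurable (reset a b s @^-1` cylinder J : set (config H)).
Proof.
move=> JH; rewrite reset_cylinder; case: ifP => // _.
by apply: measurable_cylinder => f /=; rewrite inE => /andP[_ /JH].
Qed.

(** Averaging over [s] gives a factor p for each resampled edge in [J] and 1 for each other
    resampled edge; the remaining edges of [J] contribute their own factors p. *)
Lemma pr_reset_cylinder (J : {fset set X}) : [set` J] `<=` edges H ->
  pr (cylinder J) =
  \sum_s weight (bern p) s * pr (reset a b s @^-1` cylinder J).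
Proof.
move=> JH; rewrite (pr_cylinder perc)//.
set K := [fset e i | i in I]%fset.
have pK s : pr (reset a b s @^-1` cylinder J) =
    (\prod_i (if (e i \in J) ==> s i then 1 else 0)) * p ^+ #|` (J `\` K)%fset|.
  rewrite reset_cylinder; case: forallP => [sJ|nsJ].
    rewrite big1 ?mul1r => [|i _]; last by rewrite sJ.
    rewrite (pr_cylinder perc)// => f /=; rewrite inE => /andP[_ /JH] //.
  have [i ni] : exists i, ~~ ((e i \in J) ==> s i).
    by apply/existsP; rewrite -negb_forall; apply/forallP.
  rewrite (bigD1 i)//= (negbTE ni) !mul0r /config_prob preimage_set0 measure0//.
under eq_bigr do rewrite pK mulrA /weight -big_split /=.
rewrite -mulr_suml (sum_prod_bool (fun i b =>
  bern p b * (if (e i \in J) ==> b then 1 else 0))) /=.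
have -> : #|` J| = (#|[pred i | e i \in J]| + #|` (J `\` K)%fset|)%N.
  rewrite -(cardfsID K J); congr (_ + _)%N.
  have -> : (J `&` K)%fset = [fset e i | i in [pred i | e i \in J]]%fset.
    apply/fsetP => f; rewrite inE; apply/andP/imfsetP => [[fJ /imfsetP[i _ fi]]|].
      by exists i => //=; rewrite unfold_in /= -fi.
    by move=> [i /= iJ ->]; split=> //; apply/imfsetP; exists i.
  by rewrite card_imfset//= -cardE.
rewrite exprD; congr (_ * _).
rewrite (eq_bigr (fun i => if e i \in J then p else 1)) => [|i _]; last first.
  by case: (e i \in J); rewrite /bern /=; ring.
by rewrite -big_mkcond prodr_const.
Qed.

Lemma pr_reset E : measurable E ->
  (forall s, measurable (reset a b s @^-1` E : set (config H))) /\
  pr E = \sum_s weight (bern p) s * pr (reset a b s @^-1` E).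
Proof.
apply: (pr_transfer perc) => [s|J s|J]; last exact: pr_reset_cylinder.
  by apply: weight_ge0 => x; exact: bern_ge0.
exact: measurable_reset.
Qed.

End Resampling.

(** Finite energy: resample the single edge and keep only the term in which it comes out open. *)
Lemma pr_open x y E F : adj H x y -> measurable E -> measurable F ->
  (forall c, E c -> F (c `|` [set [set x; y]])) -> p * pr E <= pr F.
Proof.
move=> xy mE mF EF.
have inj : injective (fun _ : unit => [set x; y]) by move=> [] [].
have [mr ->] := @pr_reset unit (fun=> x) (fun=> y) inj F mF.
pose s1 : {ffun unit -> bool} := [ffun=> true].
rewrite (bigD1 s1)//= -[leLHS]addr0 lerD//; last first.
  apply: sumr_ge0 => s _; rewrite mulr_ge0 ?pr_ge0//.
  by apply: weight_ge0 => ?; exact: bern_ge0.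
have -> : weight (bern p) s1 = p.
  by rewrite /weight (big_pred1 tt) ?ffunE// => -[].
have /andP[p0 _] := p01; apply: ler_wpM2l => //; apply: (pr_le perc) => //.
move=> c Ec /=; have -> : reset (fun _ : unit => x) (fun=> y) s1 c =
    c `|` [set [set x; y]].
  apply/seteqP; split=> f.
    by move=> [[i -> _]|[cf _]]; [right|left].
  have [->|nf] := pselect (f = [set x; y]).
    by move=> _; left; exists tt; rewrite ?ffunE.
  by move=> [cf|//]; right; split=> // _.
exact: EF.
Qed.

(** The main estimate. It matters that [beta] is fixed before the edges and their number. *)
Lemma expect_count_ge (alpha : R) : 0 < p -> 0 < alpha ->
  exists2 beta : R, 0 < beta &
  forall (I : finType) (a b : I -> X), (forall i, adj H (a i) (b i)) ->
    injective (fun i => [set a i; b i]) ->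
    (forall i, alpha <= pr (sepset H (a i) (b i))) ->
  beta * #|I|%:R <= expect (count_inf H R (ends a b)).
Proof.
move=> p0 a0; have /andP[_ p1] := p01.
(* First [th], then [k], are chosen so that each error term of [averaged_count] is at most p alpha /
   4 per edge. Half of p alpha remains, and dividing by k gives [beta]. *)
pose th := Num.min 2^-1 (p * alpha / 32).
have th0 : 0 < th <= 2^-1.
  by rewrite /th lt_min ge_min lexx /= andbT invr_gt0 ltr0n divr_gt0 ?mulr_gt0.
have thle : 8 * th <= p * alpha / 4.
  have : th <= p * alpha / 32 by rewrite /th ge_min lexx orbT.
  by move: (th) => t; lra.
have [k k0 kle] : exists2 k : nat, (0 < k)%N &
    8 / (th ^+ 3 * k%:R) <= p * alpha / 4.
  have c0 : 0 < p * alpha / 4 * th ^+ 3.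
    by case/andP: th0 => t0 _; rewrite !mulr_gt0// ?exprn_gt0.
  pose k := (Num.truncn (8 / (p * alpha / 4 * th ^+ 3))).+1.
  exists k => //; have kgt : 8 / (p * alpha / 4 * th ^+ 3) < k%:R.
    exact: truncnS_gt.
  case/andP: th0 => t0 _.
  rewrite ler_pdivrMr; last by rewrite mulr_gt0 ?exprn_gt0 ?ltr0n.
  by rewrite mulrA -ler_pdivrMl// mulrC ltW.
exists (p * alpha / 2 / k%:R); first by rewrite !divr_gt0 ?mulr_gt0 ?ltr0n.
move=> I a b ab inj sepge.
pose q (c : config H) : R := \sum_i (`[< sepset H (a i) (b i) c >] : nat)%:R.
have sq : simple q.
  by apply: simple_sum => i; apply: simple_asbool; exact: measurable_sepset.
have sc := simple_count H R (ends a b).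
have [srq exq] := expect_transfer (@pr_reset I a b inj) sq.
have [src exc] := expect_transfer (@pr_reset I a b inj) sc.
have exq' : alpha * #|I|%:R <= expect q.
  rewrite /q expect_sum => [|i]; last first.
    by apply: simple_asbool; exact: measurable_sepset.
  rewrite mulr_natr -sumr_const; apply: ler_sum => i _.
  by rewrite expect_asbool//; exact: measurable_sepset.
have avg : p * expect q <= k%:R * expect (count_inf H R (ends a b)) +
    (8 * th + 8 / (th ^+ 3 * k%:R)) * #|I|%:R.
  (* Both sides are gathered into one expectation, under which [averaged_count] holds for every
     fixed [c]. *)
  rewrite exq exc.
  have sZ f : (forall s, simple (fun c : config H => f (reset a b s c))) ->
      simple (fun c : config H =>
        \sum_s weight (bern p) s * f (reset a b s c)).
    by move=> sf; apply: simple_sum => s; apply: simpleZ.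
  have exS f : (forall s, simple (fun c : config H => f (reset a b s c))) ->
      \sum_s weight (bern p) s * expect (fun c => f (reset a b s c)) =
      expect (fun c => \sum_s weight (bern p) s * f (reset a b s c)).
    move=> sf; rewrite expect_sum => [|s]; last exact: simpleZ.
    by apply: eq_bigr => s _; rewrite expectZ.
  rewrite !exS// -expectZ; last exact: sZ.
  rewrite -expectZ; last exact: sZ.
  rewrite -[(8 * th + _) * _]expect_cst.
  rewrite -expectD; last exact: simple_cst; last first.
    by apply: simpleZ; exact: sZ.
  apply: expect_le => [||c].
  - by apply: simpleZ; exact: sZ.
  - by apply: simpleD; [apply: simpleZ; exact: sZ|exact: simple_cst].
  - exact: averaged_count.
have m0 : 0 <= #|I|%:R :> R by [].
have k0' : 0 < k%:R :> R by rewrite ltr0n.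
rewrite mulrAC ler_pdivrMr//; have := ler_wpM2l (ltW p0) exq'.
have : (8 * th + 8 / (th ^+ 3 * k%:R)) * #|I|%:R <= p * alpha / 2 * #|I|%:R.
  by apply: ler_wpM2r => //; lra.
move: avg.
move: (8 * th + _) (expect q) (expect (count_inf H R (ends a b))) => A B C.
have -> : C * k%:R = k%:R * C by rewrite mulrC.
have -> : p * (alpha * #|I|%:R) = p * alpha * #|I|%:R by rewrite mulrA.
have -> : p * alpha / 2 * #|I|%:R = p * alpha * #|I|%:R / 2 by rewrite mulrAC.
move: (p * alpha * _) (A * _) (p * B) (k%:R * C) => x y z t.
by move=> h1 h2 h3; lra.
Qed.

End Expectation.

(** * Invariance under graph automorphisms *)

Section Automorphism.
Variables (X : countType) (H : graph X).
Variables (R : realType) (p : R).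
Variables (d : measure_display) (T : measurableType d) (P : probability T R).
Variable omega : T -> set (set X).
Hypothesis perc : bernoulli_percolation P H p omega.
Variables f g : X -> X.
Hypotheses (fK : cancel f g) (gK : cancel g f).
Hypothesis fH : forall x y, adj H (f x) (f y) <-> adj H x y.

Local Notation pr := (@config_prob X H R d T P omega).

Definition image_edge (e : set X) : set X := f @` e.

Definition pullback (c : set (set X)) : set (set X) :=
  [set e | c (image_edge e)].

Let f_set2 x y : f @` [set x; y] = [set f x; f y].
Proof. by rewrite image_setU !image_set1. Qed.

Let f_edge e : edges H e -> edges H (f @` e).
Proof. by move=> [x [y [xy ->]]]; exists (f x), (f y); rewrite f_set2 fH. Qed.

Lemma pullback_cylinder (J : {fset set X}) :
  pullback @^-1` cylinder J = cylinder [fset image_edge e | e in J]%fset.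
Proof.
apply/seteqP; split=> c cJ e.
  by move=> /imfsetP[/= e' eJ ->]; exact: cJ.
by move=> eJ; apply: cJ; apply/imfsetP; exists e.
Qed.

(** An automorphism maps cylinders to cylinders over equally many edges. The sum over [unit] only
    fits the format of [pr_transfer]. *)
Lemma pr_pullback (E : set (config H)) : measurable E ->
  (forall _ : unit, measurable (pullback @^-1` E : set (config H))) /\
  pr E = \sum_(u : unit) 1 * pr (pullback @^-1` E).
Proof.
have sub (J : {fset set X}) : [set` J] `<=` edges H ->
    [set` [fset image_edge e | e in J]%fset] `<=` edges H.
  by move=> JH _ /= /imfsetP[/= e /JH He ->]; exact: f_edge.
move=> mE; have := @pr_transfer _ _ _ _ _ _ _ _ perc unit (fun=> 1)
  (fun=> pullback); apply => //.
  by move=> J _ /sub JH; rewrite pullback_cylinder; exact: measurable_cylinder.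
move=> J JH; rewrite big_const card_unit /= addr0 mul1r pullback_cylinder.
rewrite !(pr_cylinder perc) ?card_imfset//=; last exact: sub.
move=> e e' ee'; apply/seteqP; split=> x expect.
  have : image_edge e' (f x) by rewrite -ee'; exists x.
  by move=> [y e'y /(can_inj fK) <-].
have : image_edge e (f x) by rewrite ee'; exists x.
by move=> [y ey /(can_inj fK) <-].
Qed.

Lemma pcluster_pullback c x y :
  pcluster H (pullback c) x y <-> pcluster H c (f x) (f y).
Proof.
split=> [|xy].
  move: y; apply: (@component_sub _ _ [set y | pcluster H c (f x) (f y)]).
    exact: pcluster_refl.
  move=> u v xu [uv cuv]; apply: (pcluster_trans xu).
  by apply: pcluster_adj; rewrite ?fH// -f_set2.
rewrite -(fK x) -(fK y); move: (f x) (f y) xy => {x y} x.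
apply: (@component_sub _ _ [set y | pcluster H (pullback c) (g x) (g y)]).
  exact: pcluster_refl.
move=> u v xu [uv cuv]; apply: (pcluster_trans xu).
apply: pcluster_adj; first by rewrite -fH !gK.
by rewrite /pullback /image_edge /= f_set2 !gK.
Qed.

Lemma inf_cluster_pullback c x :
  inf_cluster H (pullback c) x <-> inf_cluster H c (f x).
Proof.
have E : pcluster H (pullback c) x = f @^-1` pcluster H c (f x).
  by apply/seteqP; split=> y xy; apply/pcluster_pullback.
rewrite /inf_cluster E; split=> ic fin; apply: ic.
  by apply: finite_preimage => // y z _ _; exact: (can_inj fK).
have := finite_image f fin; rewrite image_preimage// -subTset => y _.
by exists (g y).
Qed.

Lemma sep_prob_auto x y : pr (sepset H (f x) (f y)) = pr (sepset H x y).
Proof.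
have [_ ->] := pr_pullback (@measurable_sepset X H x y).
rewrite big_const card_unit /= addr0 mul1r; congr (config_prob _ _ _).
apply/seteqP; split=> c [ix iy nxy]; split=> [||xy].
- exact/inf_cluster_pullback.
- exact/inf_cluster_pullback.
- exact/nxy/pcluster_pullback.
- exact/inf_cluster_pullback.
- exact/inf_cluster_pullback.
- exact/nxy/pcluster_pullback.
Qed.

End Automorphism.

(** * From edge cuts to finite vertex cuts *)

Lemma component_delete_boundary (V : Type) (G : graph V) (F : set (set V))
    (A : set V) u v :
  let B := \bigcup_(x in A) component (delete_edges G F) x in
  B u -> ~ B v -> adj G u v -> F [set u; v].
Proof.
move=> B [x Ax xu] nBv uv; apply: contrapT => nF; apply: nBv; exists x => //.
by apply: (component_trans xu); apply: component_adj.
Qed.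

(** [W] may exceed the true outer boundary, but it must avoid [B]: this is what later makes cut
    columns differ from those already enclosed. *)
Definition outer_boundary (V : choiceType) (G : graph V) (B W : seq V) :=
  {subset W <= [predC B]} /\
  forall u v, u \in B -> v \notin B -> adj G u v -> v \in W.

(** [B] is the finite union of the components of [A] after the deletion. Every edge leaving [B] was
    deleted and has a single end outside, so the outside ends number at most [K]. *)
Lemma boundedly_separable_cut (V : choiceType) (G : graph V) :
  boundedly_separable G -> exists K, forall A : seq V, exists B W : seq V,
    [/\ {subset A <= B}, outer_boundary G B W & (size W <= K)%N].
Proof.
move=> [K sep]; exists K => A.
have [F [FG FK Ffin]] := sep [set` A] (finite_seq A).
pose Bs := \bigcup_(x in [set` A]) component (delete_edges G F) x.
have [B BE] : exists B : seq V, Bs = [set` B].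
  by apply/finite_seqP; exact: bigcup_finite.
have memB x : x \in B <-> Bs x by rewrite BE.
have finF : finite_set F := card_le_finite FK (finite_II K).
pose S : seq (set V) := fset_set F.
have SK : (size S <= K)%N by exact: geq_card_fset_set.
(* The outside end of [e], determined as soon as the other end lies in [Bs]. *)
have outer (e : set V) :
    exists w, forall u v, e = [set u; v] -> Bs u -> ~ Bs v -> w = Some v.
  have [[v [ev nBv]]|nex] := pselect (exists v, e v /\ ~ Bs v); last first.
    exists None => u v euv _ nBv; exfalso; apply: nex; exists v.
    by rewrite euv; split=> //; right.
  exists (Some v) => u w euw Bu _; move: ev; rewrite euw.
  by move=> [vu|->//]; move: nBv; rewrite vu.
(* For an edge that does not leave [B] the chosen value is unknown, so vertices of [B] are filtered
   out. *)
exists B, [seq w <- pmap (fun e => sval (cid (outer e))) S | w \notin B]; split.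
- by move=> x xA; apply/memB; exists x => //; exact: component_refl.
- split=> [w|u v uB vB uv]; first by rewrite mem_filter => /andP[].
  have Bu : Bs u by exact/memB.
  have nBv : ~ Bs v by move=> /memB; exact/negP.
  have Fuv : F [set u; v].
    exact: (@component_delete_boundary _ G F [set` A] u v).
  rewrite mem_filter /= vB mem_pmap; apply/mapP; exists [set u; v].
    by rewrite in_fset_set// inE.
  by case: cid => /= w /(_ _ _ erefl Bu nBv) ->.
- rewrite (leq_trans _ SK)// size_filter (leq_trans (count_size _ _))//.
  by rewrite size_pmap count_size.
Qed.

(** * Cuts of the product graph *)

Section Boxes.
Variables (V : countType) (G : graph V).
Local Notation X := (V * int)%type.
Local Notation H := (prodZ G).
Implicit Types (A B W : seq V) (h z : int) (n k : nat).

Definition box A h n : seq X := [seq (v, h + k%:Z) | v <- A, k <- iota 0 n].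

Lemma mem_box A h n v z :
  reflect (v \in A /\ exists2 k, (k < n)%N & z = h + k%:Z)
          ((v, z) \in box A h n).
Proof.
apply: (iffP allpairsP) => [[[w k] /= [wA kn [-> ->]]]|[vA [k kn ->]]].
  by split=> //; exists k => //; move: kn; rewrite mem_iota.
by exists (v, k); rewrite mem_iota.
Qed.

(** An infinite cluster must leave the finite box over [B]. It does so horizontally, entering the
    box over [W], or vertically, from one of the 2 |B| vertices of the bottom and top layers. *)
Lemma box_cut A B W h n c : {subset A <= B} -> outer_boundary G B W ->
  (nclusters H c (box A h n) <=
   nclusters H c (box W h n) + 2 * size B)%N.
Proof.
move=> AB [_ BW]; case: n => [|n].
  by rewrite (leq_trans (nclusters_size _ _ _))// size_allpairs muln0.
pose lid := [seq (v, h) | v <- B] ++ [seq (v, h + n%:Z) | v <- B].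
apply: (@leq_trans (nclusters H c (box W h n.+1 ++ lid))); last first.
  rewrite (leq_trans (nclusters_cat _ _ _ _))// leq_add2l.
  rewrite (leq_trans (nclusters_size _ _ _))//.
  by rewrite size_cat !size_map mul2n addnn.
apply: nclusters_le => -[a z] /mem_box[aA [k kn ->]] ia.
have [y ay nBy] :
    exists2 y, pcluster H c (a, h + k%:Z) y & y \notin box B h n.+1.
  apply: contra_notP ia => nex; apply: (@sub_finite_set _ _ [set` box B h n.+1]).
    move=> y ay /=; apply: contra_notT nex => yB; by exists y.
  exact: finite_seq.
have aB : (a, h + k%:Z) \in box B h n.+1.
  by apply/mem_box; split; [exact: AB|exists k].
have [[b zb] [[w zw] [/= bB nwB [adjbw _] ab aw]]] :=
  @component_exit _ (spanning_subgraph H c) [set` box B h n.+1]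
    (a, h + k%:Z) y aB (elimN idP nBy) ay.
have /mem_box[{}bB [j jn zbE]] := bB.
case: adjbw => /= [[bw bz]|[zbw bw]].
  exists (b, zb) => //; rewrite mem_cat; apply/orP; right.
  have [j0|jN0] := eqVneq j 0%N.
    by rewrite mem_cat zbE j0 addr0 map_f.
  have [jE|jNn] := eqVneq j n.
    rewrite mem_cat zbE jE; apply/orP; right.
    by apply/mapP; exists b.
  (* A vertical move from an inner layer stays inside the box. *)
  exfalso; apply: nwB; apply/mem_box; rewrite -bw; split=> //.
  exists (`|zw - h|)%N; lia.
exists (w, zw) => //; rewrite mem_cat; apply/orP; left; apply/mem_box; split.
  apply: BW bw => //; apply/negP => wB; apply: nwB; apply/mem_box.
  by split=> //; exists j => //; rewrite -zbw.
by exists j => //; rewrite -zbw.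
Qed.

Definition shift z (x : X) : X := (x.1, x.2 + z).

Lemma shiftK z : cancel (shift z) (shift (- z)).
Proof. by move=> [v k]; rewrite /shift /= addrK. Qed.

Lemma shiftNK z : cancel (shift (- z)) (shift z).
Proof. by move=> [v k]; rewrite /shift /= subrK. Qed.

Lemma shift_adj z x y : adj H (shift z x) (shift z y) <-> adj H x y.
Proof.
have E : x.2 + z - (y.2 + z) = x.2 - y.2 by lia.
by split=> -[[/= e1 e2]|[/= e1 e2]]; [left|right|left|right]; split=> //;
  rewrite /shift /= ?E// in e2 *; lia.
Qed.

Lemma box_cat A h m n : box A h (m + n) =i box A h m ++ box A (h + m%:Z) n.
Proof.
move=> [v z]; rewrite mem_cat; apply/mem_box/orP => [[vA [k kmn ->]]|].
  have [km|mk] := ltnP k m; [left|right]; apply/mem_box; split=> //.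
    by exists k.
  by exists (k - m)%N; lia.
move=> [|] /mem_box[vA [k kn ->]]; split=> //.
  by exists k => //; rewrite ltn_addr.
by exists (m + k)%N; lia.
Qed.

End Boxes.

(** * Separation probabilities *)

Section Uniqueness.
Variables (V : countType) (G : graph V).
Hypothesis Gconn : connected_graph G.
Hypothesis Gsep : boundedly_separable G.
Variables (R : realType) (p : R) (p01 : 0 <= p <= 1) (p_gt0 : 0 < p).
Variables (d : measure_display) (T : measurableType d) (P : probability T R).
Local Notation X := (V * int)%type.
Local Notation H := (prodZ G).
Variable omega : T -> set (set X).
Hypothesis perc : bernoulli_percolation P H p omega.

Local Notation pr := (@config_prob (V * int)%type H R d T P omega).
Local Notation expect := (@config_expect (V * int)%type H R d T P omega).

Definition sep_prob x y : R := pr (sepset H x y).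
Definition mean_count (U : seq X) : R := expect (count_inf H R U).

Definition merge_factor : R := 1 + p^-1.

Lemma merge_factor_ge0 : 0 <= merge_factor.
Proof. by rewrite addr_ge0// invr_ge0 ltW. Qed.
Local Hint Resolve merge_factor_ge0 : core.

Lemma sep_prob_ge0 x y : 0 <= sep_prob x y.
Proof. exact: pr_ge0. Qed.

Lemma sep_prob_xx x : sep_prob x x = 0.
Proof.
rewrite /sep_prob /config_prob (_ : sepset H x x = set0).
  by rewrite preimage_set0 measure0.
by apply/seteqP; split=> // c [_ _ []]; exact: pcluster_refl.
Qed.

Lemma sep_prob_sym x y : sep_prob x y = sep_prob y x.
Proof.
by congr (config_prob _ _ _); apply/seteqP; split=> c; exact: infsep_sym.
Qed.

(** By [infsep_third], the case left over is that [z] has a finite cluster; opening the edge xz then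
    separates [z] from [y], at the cost of a factor 1/p. *)
Lemma sep_prob_step x y z : adj H x z ->
  sep_prob x y <= sep_prob x z + merge_factor * sep_prob z y.
Proof.
move=> xz.
pose N : set (config H) := sepset H x y `\` [set c | inf_cluster H c z].
have mD u v := @measurable_sepset _ H u v.
have mN : measurable N.
  by apply: measurableD => //; exact: measurable_inf_cluster.
have pN : p * pr N <= sep_prob z y.
  apply: (pr_open p01 perc xz) => // c [Dxy nz].
  exact: infsep_add.
have : sep_prob x y <= sep_prob x z + (sep_prob z y + pr N).
  apply: (@le_trans _ _ (pr (sepset H x z `|` (sepset H z y `|` N)))).
    apply: (pr_le perc) => //.
      by apply: measurableU => //; exact: measurableU.
    move=> c Dc; have [|[|]] := infsep_third z Dc; [by left|by right; left|].
    by move=> nz; right; right.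
  apply: le_trans (prU_le perc _ _) _ => //; first exact: measurableU.
  by rewrite lerD2l; exact: (prU_le perc).
move=> /le_trans; apply; rewrite lerD2l /merge_factor mulrDl mul1r lerD2l.
by rewrite ler_pdivlMl.
Qed.

Lemma sep_prob_shift z x y : sep_prob (shift z x) (shift z y) = sep_prob x y.
Proof.
exact: (sep_prob_auto perc (@shiftK _ z) (@shiftNK _ z)
  (@shift_adj V G z)).
Qed.

Lemma mean_count_le U W (m : nat) :
    (forall c, (nclusters H c U <= nclusters H c W + m)%N) ->
  mean_count U <= mean_count W + m%:R.
Proof.
move=> UW; have sW := simple_count H R W.
rewrite /mean_count -[X in _ <= _ + X](@expect_cst _ H _ _ _ P omega).
rewrite -(expectD perc)//; last exact: simple_cst.
apply: (expect_le perc) => [||c].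
- exact: simple_count.
- by apply: simpleD => //; exact: simple_cst.
- by rewrite /count_inf -natrD ler_nat.
Qed.

Lemma mean_count_sub U W : {subset U <= W} -> mean_count U <= mean_count W.
Proof.
move=> UW; rewrite -[leRHS]addr0; apply: (@mean_count_le _ _ 0) => c.
rewrite addn0; apply: nclusters_le => u uU _; exists u; first exact: UW.
exact: pcluster_refl.
Qed.

Lemma mean_count_cat U W : mean_count (U ++ W) <= mean_count U + mean_count W.
Proof.
rewrite /mean_count -(expectD perc); try exact: simple_count.
apply: (expect_le perc) => [||c].
- exact: simple_count.
- by apply: simpleD; exact: simple_count.
- by rewrite /count_inf -natrD ler_nat; exact: nclusters_cat.
Qed.

Lemma mean_count_size U : mean_count U <= (size U)%:R.
Proof.
have -> : (size U)%:R = mean_count [::] + (size U)%:R.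
  suff -> : mean_count [::] = 0 by rewrite add0r.
  exact: expect_cst.
apply: mean_count_le => c.
by rewrite (leq_trans (nclusters_size _ _ _))// leq_addl.
Qed.

Lemma mean_count_sepr U :
  mean_count U <= 1 + \sum_(u <- U) \sum_(v <- U) sep_prob u v.
Proof.
pose q u v (c : config H) : R := (`[< sepset H u v c >] : nat)%:R.
have sq u v : simple (q u v).
  by apply: simple_asbool; exact: measurable_sepset.
have sqs u : simple (fun c => \sum_(v <- U) q u v c) by exact: simple_sum.
have -> : 1 + \sum_(u <- U) \sum_(v <- U) sep_prob u v =
    expect (fun c => 1 + \sum_(u <- U) \sum_(v <- U) q u v c).
  rewrite (expectD perc); [|exact: simple_cst|exact: simple_sum].
  rewrite expect_cst (expect_sum perc)//; congr (_ + _).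
  apply: eq_bigr => u _; rewrite (expect_sum perc)//.
  apply: eq_bigr => v _; rewrite (expect_asbool perc)//.
  exact: measurable_sepset.
apply: (expect_le perc) => [||c].
- exact: simple_count.
- by apply: simpleD; [exact: simple_cst|exact: simple_sum].
- have := nclusters_infsep H c U; rewrite -(ler_nat R) natrD natr_sum.
  by under eq_bigr do rewrite natr_sum.
Qed.

(** The constant produced by [n] uses of [sep_prob_step] along a vertical path; by translation every
    edge contributes the same [column_sep]. It is the same for all columns. *)
Fixpoint path_factor (n : nat) : R :=
  if n is m.+1 then 1 + merge_factor * path_factor m else 0.

Lemma path_factor_ge0 n : 0 <= path_factor n.
Proof. by elim: n => //= n IH; rewrite addr_ge0// mulr_ge0. Qed.

Lemma path_factor_le m n : (m <= n)%N -> path_factor m <= path_factor n.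
Proof.
elim: m n => [|m IH] [|n]//= mn.
  by rewrite addr_ge0// mulr_ge0// path_factor_ge0.
by rewrite lerD2l ler_wpM2l// IH.
Qed.

Definition column_sep w : R := sep_prob (w, 0) (w, 1).

Lemma sep_prob_vertical w (z : int) n :
  sep_prob (w, z) (w, z + n%:Z) <= path_factor n * column_sep w.
Proof.
elim: n z => [|n IH] z; first by rewrite addr0 sep_prob_xx mul0r.
have adjz : adj H (w, z) (w, z + 1).
  by left; split=> //=; lia.
rewrite (le_trans (sep_prob_step _ adjz))//= [leRHS]mulrDl mul1r lerD//.
  by rewrite -[leRHS](sep_prob_shift z) /shift /= add0r [1 + z]addrC.
rewrite -mulrA ler_wpM2l// (_ : z + n.+1%:Z = z + 1 + n%:Z); last by lia.
exact: IH.
Qed.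

Lemma sep_prob_vertical_lt w (h : int) (i j L : nat) : (i < L)%N -> (j < L)%N ->
  sep_prob (w, h + i%:Z) (w, h + j%:Z) <= path_factor L * column_sep w.
Proof.
wlog ij : i j / (i <= j)%N => [hwlog|] iL jL.
  have [/hwlog|/ltnW /hwlog] := leqP i j; first exact.
  by rewrite sep_prob_sym; exact.
rewrite (_ : h + j%:Z = h + i%:Z + (j - i)%N%:Z); last by lia.
apply: le_trans (sep_prob_vertical _ _ _) _; apply: ler_wpM2r.
  exact: sep_prob_ge0.
by apply: path_factor_le; rewrite (leq_trans (leq_subr _ _))// ltnW.
Qed.

(** A window of height [L] in one column has L^2 ordered pairs of vertices. *)
Definition block_factor (L : nat) : R := L%:R ^+ 2 * path_factor L.

Lemma mean_count_block w h L :
  mean_count (box [:: w] h L) <= 1 + block_factor L * column_sep w.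
Proof.
apply: le_trans (mean_count_sepr _) _; rewrite lerD2l.
have sL : size (box [:: w] h L) = L by rewrite size_allpairs size_iota mul1n.
apply: (@le_trans _ _ (\sum_(u <- box [:: w] h L) \sum_(v <- box [:: w] h L)
    path_factor L * column_sep w)).
  rewrite !big_seq; apply: ler_sum => -[u1 u2].
  move=> /mem_box[/[!inE]/eqP-> [i iL ->]].
  rewrite !big_seq; apply: ler_sum => -[v1 v2].
  move=> /mem_box[/[!inE]/eqP-> [j jL ->]].
  exact: sep_prob_vertical_lt.
rewrite !big_const_seq !count_predT !iter_addr_0 sL -mulrnA -mulr_natr.
by rewrite natrM /block_factor le_eqVlt; apply/orP; left; apply/eqP; ring.
Qed.

(** The column is cut into [q] windows of height [L], each contributing one cluster plus an error
    proportional to [column_sep]. *)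
Lemma mean_count_column w h L q :
  mean_count (box [:: w] h (L * q)) <=
  q%:R * (1 + block_factor L * column_sep w).
Proof.
elim: q => [|q IH].
  by rewrite muln0 mul0r (le_trans (mean_count_size _))// size_allpairs muln0.
rewrite mulnS addnC.
apply: (@le_trans _ _ (mean_count (box [:: w] h (L * q) ++
    box [:: w] (h + (L * q)%N%:Z) L))).
  by apply: mean_count_sub => x; rewrite box_cat.
rewrite (le_trans (mean_count_cat _ _))// -natr1 mulrDl mul1r lerD//.
exact: mean_count_block.
Qed.

Lemma mean_count_box W h n :
  mean_count (box W h n) <= \sum_(w <- W) mean_count (box [:: w] h n).
Proof.
elim: W => [|w W IH].
  by rewrite big_nil; apply: le_trans (mean_count_size _) _.
rewrite big_cons (le_trans _ (lerD (lexx _) IH))//.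
rewrite (le_trans _ (mean_count_cat _ _))//.
by apply: mean_count_sub => -[v z] /mem_box[/[!inE]/orP[/eqP->|vW] kn];
  rewrite mem_cat; apply/orP; [left|right]; apply/mem_box;
  rewrite ?inE ?eqxx.
Qed.

(* A cut has at most K columns, through which clusters pass with density at
   least beta; in windows of height L > 2 K / beta some column must therefore
   meet two infinite clusters with a probability that does not depend on the
   cut. *)
Lemma separating_columns (A0 : seq V) h (beta : R) : 0 < beta ->
    (forall n, beta * n%:R <= mean_count (box A0 h n.+1)) ->
  exists2 alpha, 0 < alpha &
    forall A : seq V, exists2 w, w \notin A & alpha <= column_sep w.
Proof.
move=> beta0 hbeta; have [K cut] := boundedly_separable_cut Gsep.
(* Per window, the lower bound beta L beats by one the upper bound of two clusters in each of [K]
   columns. *)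
pose L := (Num.truncn ((2 * K%:R + 1) / beta)).+1.
have Lgt : 2 * K%:R + 1 <= beta * L%:R.
  by rewrite [leRHS]mulrC -ler_pdivrMr//; apply/ltW/truncnS_gt.
have b0 : 0 <= block_factor L by rewrite mulr_ge0 ?exprn_ge0 ?path_factor_ge0.
(* Below this threshold a window of height [L] meets at most 1 + 1 infinite clusters on average. *)
exists (block_factor L + 1)^-1; first by rewrite invr_gt0 ltr_wpDl.
(* Enclosing [A] too forces the columns of the cut to avoid [A]. *)
move=> A; have [B [W [AB BW WK]]] := cut (A0 ++ A).
apply: contrapT => nex.
have small w : w \in W -> column_sep w <= (block_factor L + 1)^-1.
  move=> wW; apply: contra_notT nex; rewrite -ltNge => /ltW hw.
  exists w => //; apply/negP => wA; have [/(_ _ wW)/= + _] := BW.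
  by rewrite inE AB// mem_cat wA orbT.
pose N := (2 * size B)%N.
(* [hbeta] pairs n with height n + 1, hence the predecessor. *)
have main q : beta * (L * q.+1).-1%:R <= K%:R * (q.+1%:R * 2) + N%:R.
  have Lq : (L * q.+1).-1.+1 = (L * q.+1)%N by rewrite prednK// muln_gt0.
  have := hbeta (L * q.+1).-1; rewrite Lq => /le_trans; apply.
  apply: (@le_trans _ _ (mean_count (box W h (L * q.+1)) + N%:R)).
    apply: mean_count_le => c; apply: box_cut => // v vA.
    by apply: AB; rewrite mem_cat vA.
  rewrite lerD2r (le_trans (mean_count_box _ _ _))//.
  apply: (@le_trans _ _ (\sum_(w <- W) q.+1%:R * 2)).
    rewrite !big_seq; apply: ler_sum => w wW.
    rewrite (le_trans (mean_count_column _ _ _ _))// ler_wpM2l//.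
    rewrite [leRHS](_ : _ = 1 + 1)//.
    rewrite lerD2l (le_trans (ler_wpM2l b0 (small _ wW)))//.
    by rewrite ler_pdivrMr ?mul1r ?lerDl// ltr_wpDl.
  rewrite big_const_seq count_predT iter_addr_0 -[leLHS]mulr_natl ler_wpM2r//.
  by rewrite ler_nat.
(* Together [main] and [Lgt] give q + 1 <= N + beta, which this choice violates. *)
pose q := Num.truncn (N%:R + beta).
have qgt : N%:R + beta < q.+1%:R by exact: truncnS_gt.
have := main q; rewrite -subn1 natrB ?muln_gt0// natrM.
have := ler_wpM2r (ler0n R q.+1) Lgt.
by move: qgt; rewrite mulrDl mul1r; nra.
Qed.

Lemma uniq_columns (alpha : R) :
    (forall A : seq V, exists2 w, w \notin A & alpha <= column_sep w) ->
  forall n, exists ws : seq V,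
    [/\ uniq ws, size ws = n & forall w, w \in ws -> alpha <= column_sep w].
Proof.
move=> hA; elim=> [|n [ws [u s wsa]]]; first by exists [::].
have [w wws aw] := hA ws; exists (w :: ws); rewrite /= wws s; split=> // v.
by rewrite inE => /orP[/eqP->//|/wsa].
Qed.

(* J columns together meet at least beta J n infinite clusters within height n,
   whereas at most K n + O(1) can pass a cut around them. *)
Lemma no_separating_columns (alpha : R) : 0 < alpha ->
  ~ (forall A : seq V, exists2 w, w \notin A & alpha <= column_sep w).
Proof.
move=> alpha0 hA; have [K cut] := boundedly_separable_cut Gsep.
have [beta beta0 hbeta] := expect_count_ge p01 perc p_gt0 alpha0.
(* With this many columns the growth rate beta J is at least K + 1. *)
pose J := (Num.truncn ((K%:R + 1) / beta)).+1.
have Jgt : K%:R + 1 <= beta * J%:R.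
  by rewrite [leRHS]mulrC -ler_pdivrMr//; apply/ltW/truncnS_gt.
have [ws [uws sws wsa]] := uniq_columns hA J.
have [B [W [AB BW WK]]] := cut ws.
have [v0 v0B] : exists v0, v0 \in ws.
  by case: (ws) sws => // v0 s _; exists v0; rewrite mem_head.
pose N := (2 * size B)%N.
(* In each column n consecutive vertical edges span n + 1 levels, and on every level the cut has at
   most [K] vertices. *)
have main n : beta * (J * n)%:R <= K%:R * n.+1%:R + N%:R.
  pose a (jk : 'I_J * 'I_n) : X := (nth v0 ws jk.1, jk.2%:Z).
  pose b (jk : 'I_J * 'I_n) : X := (nth v0 ws jk.1, jk.2%:Z + 1).
  have ab i : adj H (a i) (b i) by left; split=> //=; lia.
  have inj : injective (fun i => [set a i; b i]).
    move=> [j k] [j' k'] e.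
    have a1 : [set a (j', k'); b (j', k')] (a (j, k)) by rewrite -e; left.
    have a2 : [set a (j, k); b (j, k)] (a (j', k')) by rewrite e; left.
    have [wj kk] : nth v0 ws j = nth v0 ws j' /\ (k : nat) = k'.
      by case: a1 => -[-> z1]; case: a2 => -[_ z2]; split=> //; lia.
    move/eqP: wj; rewrite nth_uniq ?sws// => /eqP jj.
    by congr (_, _); exact: val_inj.
  have := hbeta _ a b ab inj; rewrite card_prod !card_ord => hb.
  apply: le_trans (hb _) _ => [i|].
    have := wsa (nth v0 ws i.1); rewrite mem_nth ?sws// => /(_ isT).
    rewrite /column_sep -(sep_prob_shift i.2%:Z) /shift /= !add0r.
    move=> /le_trans; apply.
    by rewrite /a /b addrC.
  apply: (@le_trans _ _ (mean_count (box ws 0 n.+1))).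
    apply: mean_count_sub => x; rewrite mem_cat => /orP[] /codomP[[j k] ->];
      apply/mem_box; rewrite mem_nth ?sws//; split=> //.
      by exists (val k); rewrite ?add0r// ltnW// ltnS ltn_ord.
    by exists k.+1; rewrite ?ltnS ?ltn_ord//= add0r -addn1 PoszD.
  apply: (@le_trans _ _ (mean_count (box W 0 n.+1) + N%:R)).
    by apply: mean_count_le => c; exact: box_cut.
  rewrite lerD2r (le_trans (mean_count_size _))// size_allpairs size_iota.
  by rewrite -natrM ler_nat leq_mul2r WK orbT.
(* [main] at n + 1 together with [Jgt] would give n + 1 <= K + N. *)
pose n := Num.truncn (K%:R + N%:R : R).
have ngt : K%:R + N%:R < n.+1%:R :> R by exact: truncnS_gt.
have := main n.+1; rewrite natrM -[n.+2%:R]natr1.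
have := ler_wpM2r (ler0n R n.+1) Jgt.
by move: ngt; rewrite mulrDl mul1r mulrA; nra.
Qed.

Lemma sep_prob_adj x y : adj H x y -> sep_prob x y = 0.
Proof.
move=> xy; apply/eqP; rewrite eq_le sep_prob_ge0 andbT leNgt.
apply/negP => alpha0.
have [beta beta0 hbeta] := expect_count_ge p01 perc p_gt0 alpha0.
(* Both ends lie on levels h or h + 1, so the [n] vertical translates of the edge fit in a box of
   height n + 1 over two columns. *)
pose h := Num.min x.2 y.2.
have hx : x.2 = h \/ x.2 = h + 1.
  by case: xy => -[/= e1 e2]; rewrite /h; lia.
have hy : y.2 = h \/ y.2 = h + 1.
  by case: xy => -[/= e1 e2]; rewrite /h; lia.
have [] := @separating_columns [:: x.1; y.1] h beta beta0; last first.
  by move=> alpha a0; exact: no_separating_columns.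
move=> n; pose a (k : 'I_n) := shift k%:Z x; pose b (k : 'I_n) := shift k%:Z y.
have ab k : adj H (a k) (b k) by apply/shift_adj.
have inj : injective (fun k => [set a k; b k]).
  move=> k k' e; apply: val_inj => /=.
  have a1 : [set a k'; b k'] (a k) by rewrite -e; left.
  have b1 : [set a k'; b k'] (b k) by rewrite -e; right.
  have a2 : [set a k; b k] (a k') by rewrite e; left.
  have heights (u v w : X) : [set u; v] w -> w.2 = u.2 \/ w.2 = v.2.
    by move=> [->|->]; [left|right].
  by move: (heights _ _ _ a1) (heights _ _ _ b1) (heights _ _ _ a2) => /=; lia.
have := hbeta _ a b ab inj; rewrite card_ord => hb.
apply: le_trans (hb _) _ => [k|].
  by rewrite -/(sep_prob _ _) sep_prob_shift.
have memb z (k : nat) w : (k < n)%N -> z = h \/ z = h + 1 ->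
    w \in [:: x.1; y.1] -> (w, z + k%:Z) \in box [:: x.1; y.1] h n.+1.
  move=> kn [->|->] wxy; apply/mem_box; split=> //.
    by exists k; rewrite // ltnW.
  by exists k.+1; rewrite ?ltnS//; lia.
apply: mean_count_sub => u.
rewrite mem_cat => /orP[] /codomP[k ->]; apply: memb;
  by rewrite ?ltn_ord// !inE eqxx ?orbT.
Qed.

Lemma prodZ_connected x y : component H x y.
Proof.
have horiz v w z : component H (v, z) (w, z).
  elim: (Gconn v w) => [a b ab|a|a b c _ ab _ bc].
  - by apply: component_adj; right.
  - exact: component_refl.
  - exact: component_trans bc.
have up v z n : component H (v, z) (v, z + n%:Z).
  elim: n => [|n IH]; first by rewrite addr0; exact: component_refl.
  by apply: (component_trans IH); apply: component_adj; left; split=> //=; lia.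
case: x y => [v z] [w z']; apply: (component_trans (horiz v w z)).
have [zz'|/ltW z'z] := leP z z'.
  by have := up w z `|z' - z|%N; rewrite (_ : z + _ = z')//; lia.
apply: component_sym.
by have := up w z' `|z - z'|%N; rewrite (_ : z' + _ = z)//; lia.
Qed.

(** Along a path from [x] to [y], both terms of [sep_prob_step] vanish, by [sep_prob_adj] and by
    induction. *)
Lemma sep_prob_eq0 x y : sep_prob x y = 0.
Proof.
elim: (clos_rt_rt1n _ _ _ _ (prodZ_connected x y)) => [u|u v w uv _ IH].
  exact: sep_prob_xx.
apply/eqP; rewrite eq_le sep_prob_ge0 andbT (le_trans (sep_prob_step _ uv))//.
by rewrite (sep_prob_adj uv) IH mulr0 addr0.
Qed.

End Uniqueness.

(** * From separated pairs to the almost sure statement *)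

Lemma infinite_components_infsep (T : Type) (H : graph T) (c : set (set T)) :
  infinite_set (infinite_components (spanning_subgraph H c)) ->
  exists x y, infsep H c x y.
Proof.
move=> inf; have [C [iC [x CE]]] := infinite_setN0 inf.
have [D [[iD [y DE]] DC]] : exists D,
    infinite_components (spanning_subgraph H c) D /\ D <> C.
  apply: contra_notP inf => nex; apply: (@sub_finite_set _ _ [set C]) => //.
  by move=> D iD /=; apply: contra_notP nex => DC; exists D.
exists x, y; split; rewrite /inf_cluster /pcluster -?CE -?DE// => xy.
by apply: DC; rewrite DE CE; apply/esym/component_eq; rewrite -CE.
Qed.

Section NegligibleEvents.
Variables (d : measure_display) (T : measurableType d) (R : realType).
Variable P : probability T R.

Lemma negligible_bigcupT (Y : countType) (F : Y -> set T) :
  (forall y, P.-negligible (F y)) -> P.-negligible (\bigcup_y F y).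
Proof.
move=> nF; apply: (@negligibleS _ _ _ _ (\bigcup_n
  (if @choice.unpickle Y n is Some y then F y else set0))).
  by move=> t [y _ Fy]; exists (choice.pickle y) => //; rewrite choice.pickleK.
apply: negligible_bigcup => n; case: choice.unpickle => // .
exact: negligible_set0.
Qed.

End NegligibleEvents.

Lemma ae_finitely_many (V : countType) (G : graph V)
    (Gconn : connected_graph G) (Gsep : boundedly_separable G)
    (R : realType) (p : R) (p01 : 0 <= p <= 1)
    (d : measure_display) (T : measurableType d) (P : probability T R)
    (omega : T -> set (set (V * int)))
    (perc : bernoulli_percolation P (prodZ G) p omega) :
  {ae P, forall w,
    ~ infinite_set (infinite_components (spanning_subgraph (prodZ G) (omega w)))}.
Proof.
pose H := prodZ G; pose S (xy : (V * int) * (V * int)) : set T :=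
  omega @^-1` sepset H xy.1 xy.2.
apply: (@negligibleS _ _ _ P (\bigcup_xy S xy)).
  move=> w /= /contrapT /infinite_components_infsep[x [y xy]].
  by exists (x, y).
(* The case p = 0 is treated apart because [merge_factor] divides by p. There almost surely no edge
   is open, whereas a vertex with an infinite cluster has an open edge. *)
have [p0|pN0] := eqVneq p 0; last first.
  have p_gt0 : 0 < p by case/andP: p01 => p_ge0 _; rewrite lt_neqAle eq_sym pN0.
  apply: negligible_bigcupT => -[x y].
  exists (S (x, y)); split=> //.
    exact: (omega_measurable perc (measurable_sepset x y)).
  rewrite /S (prE perc); last exact: measurable_sepset.
  by have := sep_prob_eq0 Gconn Gsep p01 p_gt0 perc x y; rewrite /sep_prob => ->.
apply: (@negligibleS _ _ _ P (\bigcup_xy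
    [set w | adj H xy.1 xy.2 /\ omega w [set xy.1; xy.2]])).
  move=> w [[x y] _ [/= ix _ _]].
  have [z xz zx] : exists2 z, pcluster H (omega w) x z & z <> x.
    apply: contra_notP ix => nex; apply: (@sub_finite_set _ _ [set x]) => //.
    by move=> z xz /=; apply: contra_notP nex => zx; exists z.
  have [u [v [-> _ [uv cuv] _ _]]] :=
    @component_exit _ _ [set x] x z erefl zx xz.
  by exists (x, v).
apply: negligible_bigcupT => -[x y] /=.
have [xy|nxy] := pselect (adj H x y); last first.
  by apply: (@negligibleS _ _ _ P set0) => [w []//|]; exact: negligible_set0.
case: perc => mo Po _; have Hxy : edges H [set x; y] by exists x, y.
exists [set w | omega w [set x; y]]; split; first exact: mo.
  by rewrite Po// p0.
by move=> w [].
Qed.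

(** Separating a single vertex shows local finiteness: a neighbour is reached through one of at most
    [K] deleted edges or lies in a finite component. By connectedness [V] is then a countable union
    of finite balls. *)
Lemma boundedly_separable_countable (V : Type) (G : graph V) :
  connected_graph G -> boundedly_separable G -> countable [set: V].
Proof.
move=> Gconn [K sep].
have fin_adj v : finite_set [set w | adj G v w].
  have [F [_ FK /(_ v erefl) Ffin]] := sep [set v] (finite_set1 v).
  apply: (@sub_finite_set _ _ (component (delete_edges G F) v `|`
      (fun w => [set v; w]) @^-1` F)).
    move=> w vw; have [Fvw|nF] := pselect (F [set v; w]); [by right|left].
    exact: component_adj.
  rewrite finite_setU; split=> //; apply: finite_preimage.
    move=> w w' _ _ e; have : [set v; w'] w by rewrite -e; right.
    move=> [wv|//]; have : [set v; w] w' by rewrite e; right.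
    by move=> [->|->].
  exact: card_le_finite FK (finite_II K).
have [[v0 _]|nV] := pselect (exists v : V, True); last first.
  rewrite (_ : [set: V] = set0)//; apply/seteqP; split=> // v _.
  by apply: nV; exists v.
pose fix ball n : set V :=
  if n is m.+1 then \bigcup_(v in ball m) [set w | adj G v w] else [set v0].
apply: (@sub_countable _ _ _ (\bigcup_n ball n)).
  apply: subset_card_le => v _; elim: (clos_rt_rtn1 _ _ _ _ (Gconn v0 v)).
    by exists 0%N.
  by move=> u w uw _ [n _ nu]; exists n.+1 => //; exists u.
apply: bigcup_countable => // n _; apply: finite_set_countable.
by elim: n => [|n IH] /=; [exact: finite_set1|exact: bigcup_finite].
Qed.

Theorem theorem2 (V : Type) (G : graph V)
    (Gconn : connected_graph G) (Gsep : boundedly_separable G)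
    (R : realType) (p : R) (p01 : 0 <= p <= 1)
    (d : measure_display) (T : measurableType d) (P : probability T R)
    (omega : T -> set (set (V * int)))
    (perc : bernoulli_percolation P (prodZ G) p omega) :
  {ae P, forall w,
    ~ infinite_set (infinite_components (spanning_subgraph (prodZ G) (omega w)))}.
Proof.
(* Measurability uses countable unions over vertices, so [V] is replaced by a [countType] with the
   same carrier. *)
have [V' VE] := Pcountable (boundedly_separable_countable Gconn Gsep).
by subst V; exact: (ae_finitely_many Gconn Gsep p01 perc).
Qed.
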